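(* Let $\beta\in(0,1)$ be fixed, observations noiseless, $\Psi=\Psi_M$ (Matérn with $\nu>d/2$), and let $\widehat{CI}_{n,\beta}$ be the confidence interval centered at $\hat f_n$ with $\hat\sigma^2=1$, i.e. $|\widehat{CI}_{n,\beta}(x)|=2q\sqrt{1-r(x)^TR^{-1}r(x)}$, $q=\Phi^{-1}(1-\beta/2)$. For any sampling scheme $\mathcal{X}$ satisfying the fill distance condition, for all $n$ $$\sup_{\|f\|_{\mathcal{N}_\Psi(\Omega)}\le1}\big\|(f-\hat f_n)/|\widehat{CI}_{n,\beta}|\big\|_{L_\infty(\Omega)}\le\frac{1}{2q},$$ and for any increasing sequence $\{a_n\}$ with $a_n\to\infty$ there is a constant $C>0$ (depending on $\beta,\Omega,\Psi$ and the fill distance constants, not on $n$) such that for all $n$ $$\sup_{\|f\|_{\mathcal{N}_\Psi(\Omega)}\le a_n}\big\|(f-\hat f_n)/|\widehat{CI}_{n,\beta}|\big\|_{L_\infty(\Omega)}\ge Ca_n.$$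
   Context: $\Omega\subset\mathbb{R}^d$ is convex and compact with positive Lebesgue measure. Matérn correlation: $\Psi_M(h)=\frac{1}{\Gamma(\nu-d/2)2^{\nu-d/2-1}}\|h\|_2^{\nu-d/2}K_{\nu-d/2}(\|h\|_2)$. $\mathcal{N}_\Psi(\Omega)$: RKHS of $\Psi$ on $\Omega$, defined as restrictions of $\mathcal{N}_\Psi(\mathbb{R}^d)=\{f\in L_2\cap C:\mathcal{F}(f)/\sqrt{\mathcal{F}(\Psi)}\in L_2\}$ (norm$^2$ $(2\pi)^{-d/2}\int|\mathcal{F}(f)|^2/\mathcal{F}(\Psi)$) with the infimum-over-extensions norm. Sampling scheme: sequence $\{X_n\}$ of sets of $n$ distinct points of $\Omega$; fill distance condition: $\sup_{x\in\Omega}\min_{x_j\in X}\|x-x_j\|_2\asymp n^{-1/d}$. For $X=\{x_1,\dots,x_n\}$: $Y=(f(x_k))_k$, $r(x)=(\Psi(x-x_k))_k$, $R=(\Psi(x_j-x_k))_{jk}$, $\hat f_n(x)=r(x)^TR^{-1}Y$. Convention $0/0=0$. *)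

(* Defs.v *)
From HB Require Import structures.
From mathcomp Require Import all_boot all_order all_algebra.
From mathcomp Require Import all_classical all_reals all_analysis.
Set Implicit Arguments. Unset Strict Implicit. Unset Printing Implicit Defensive.
Import Order.TTheory GRing.Theory Num.Def Num.Theory.
Import numFieldNormedType.Exports.
Local Open Scope classical_set_scope.
Local Open Scope ring_scope.

Section GPDefs.
Variable R : realType.

Definition enorm {d : nat} (x : 'rV[R]_d) : R := Num.sqrt (\sum_i (x 0 i) ^+ 2).
Definition dotp {d : nat} (x y : 'rV[R]_d) : R := \sum_i x 0 i * y 0 i.

(* ---------- Lebesgue integral on R^d (iterated one-dimensional Lebesgue integrals;
   by Tonelli this is the d-dimensional Lebesgue integral of nonnegative measurable
   functions) ---------- *)
Fixpoint iint (d : nat) : ('rV[R]_d -> \bar R) -> \bar R :=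
  match d with
  | 0%N => fun f => f 0
  | d'.+1 => fun f =>
      (\int[@lebesgue_measure R]_(a in [set: R])
         iint (fun t : 'rV[R]_d' => f (row_mx (a%:M : 'M[R]_1) t)))%E
  end.

Definition Rint {d : nat} (f : 'rV[R]_d -> R) : \bar R :=
  (iint (fun x => (Num.max (f x) 0)%:E) - iint (fun x => (Num.max (- f x) 0)%:E))%E.

(* Borel measurability on R^d (product sigma-algebra on d.-tuple R) *)
Definition Rd_measurable {d : nat} (g : 'rV[R]_d -> R) : Prop :=
  measurable_fun [set: d.-tuple R] (fun t : d.-tuple R => g (\row_i tnth t i)).

Definition integrable1 {d : nat} (g : 'rV[R]_d -> R) : Prop :=
  Rd_measurable g /\ (iint (fun x => `|g x|%:E) < +oo)%E.
Definition square_integrable {d : nat} (g : 'rV[R]_d -> R) : Prop :=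
  Rd_measurable g /\ (iint (fun x => (g x ^+ 2)%:E) < +oo)%E.

Definition leb_measure {d : nat} (A : set 'rV[R]_d) : \bar R :=
  iint (fun x => (\1_A x)%:E).

Definition Linf_on {d : nat} (Omega : set 'rV[R]_d) (h : 'rV[R]_d -> R) : \bar R :=
  ereal_inf [set M : \bar R |
    leb_measure [set x | Omega x /\ (M < (`|h x|)%:E)%E] = 0%E].

Definition FT_re {d : nat} (f : 'rV[R]_d -> R) (w : 'rV[R]_d) : R :=
  powR (pi *+ 2) (- (d%:R / 2)) * fine (Rint (fun x => f x * cos (dotp x w))).
Definition FT_im {d : nat} (f : 'rV[R]_d -> R) (w : 'rV[R]_d) : R :=
  - (powR (pi *+ 2) (- (d%:R / 2)) * fine (Rint (fun x => f x * sin (dotp x w)))).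

(* (gr, gi) is the L2 Fourier transform of f in L2, characterized by duality:
   \int F(f) phi = \int f F(phi) for all phi in L1 /\ L2 *)
Definition is_L2_FT {d : nat} (f gr gi : 'rV[R]_d -> R) : Prop :=
  square_integrable gr /\ square_integrable gi /\
  forall phi : 'rV[R]_d -> R, integrable1 phi -> square_integrable phi ->
    Rint (fun w => gr w * phi w) = Rint (fun x => f x * FT_re phi x) /\
    Rint (fun w => gi w * phi w) = Rint (fun x => f x * FT_im phi x).

(* Native space N_Psi(R^d): continuous L2 functions f with F(f)/sqrt(F(Psi)) in L2;
   squared norm (2 pi)^{-d/2} \int |F f|^2 / F(Psi).  Psi is real and even, so
   F(Psi) is real: F(Psi) = FT_re Psi. *)
Definition native_sqnorm_is {d : nat} (Psi : 'rV[R]_d -> R) (f : 'rV[R]_d -> R)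
  (v : R) : Prop :=
  continuous f /\ square_integrable f /\
  exists gr gi, is_L2_FT f gr gi /\
    Rd_measurable (fun w => (gr w ^+ 2 + gi w ^+ 2) / FT_re Psi w) /\
    (iint (fun w => ((gr w ^+ 2 + gi w ^+ 2) / FT_re Psi w)%:E) < +oo)%E /\
    v = powR (pi *+ 2) (- (d%:R / 2)) *
        fine (iint (fun w => ((gr w ^+ 2 + gi w ^+ 2) / FT_re Psi w)%:E)).

(* Norm of N_Psi(Omega): infimum of the norms of all extensions in N_Psi(R^d)
   (+oo if there is none) *)
Definition native_norm_on {d : nat} (Psi : 'rV[R]_d -> R) (Omega : set 'rV[R]_d)
  (f : 'rV[R]_d -> R) : \bar R :=
  ereal_inf [set (Num.sqrt v)%:E | v in
    [set v | exists F, native_sqnorm_is Psi F v /\ (forall x, Omega x -> F x = f x)]].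

Definition Gamma (s : R) : R :=
  fine (\int[@lebesgue_measure R]_(t in [set t : R | (0 < t)%R]) (powR t (s - 1) * expR (- t))%:E)%E.
Definition cosh (t : R) : R := (expR t + expR (- t)) / 2.
Definition BesselK (a r : R) : R :=
  fine (\int[@lebesgue_measure R]_(t in [set t : R | (0 < t)%R]) (expR (- (r * cosh t)) * cosh (a * t))%:E)%E.

(* Psi_M(h) = ||h||^{nu-d/2} K_{nu-d/2}(||h||) / (Gamma(nu-d/2) 2^{nu-d/2-1}),
   with its continuous extension Psi_M(0) = 1 *)
Definition Matern (d : nat) (nu : R) (h : 'rV[R]_d) : R :=
  let a := nu - d%:R / 2 in
  if h == 0 then 1
  else (Gamma a * powR 2 (a - 1))^-1 * powR (enorm h) a * BesselK a (enorm h).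

Definition kvec {d n : nat} (Psi : 'rV[R]_d -> R) (X : 'I_n -> 'rV[R]_d)
  (x : 'rV[R]_d) : 'cV[R]_n := \col_k Psi (x - X k).
Definition kmat {d n : nat} (Psi : 'rV[R]_d -> R) (X : 'I_n -> 'rV[R]_d) : 'M[R]_n :=
  \matrix_(j, k) Psi (X j - X k).
Definition interp {d n : nat} (Psi : 'rV[R]_d -> R) (X : 'I_n -> 'rV[R]_d)
  (f : 'rV[R]_d -> R) (x : 'rV[R]_d) : R :=
  ((kvec Psi X x)^T *m invmx (kmat Psi X) *m (\col_k f (X k))) 0 0.
Definition CI_length {d n : nat} (Psi : 'rV[R]_d -> R) (X : 'I_n -> 'rV[R]_d) (q : R)
  (x : 'rV[R]_d) : R :=
  2 * q * Num.sqrt (1 - ((kvec Psi X x)^T *m invmx (kmat Psi X) *m kvec Psi X x) 0 0).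

(* sup_{||f||_{N_Psi(Omega)} <= a} || (f - f_n)/|CI_n| ||_{L_oo(Omega)}
   (division by 0 gives 0 in MathComp: convention 0/0 = 0) *)
Definition worst_ratio {d n : nat} (Psi : 'rV[R]_d -> R) (Omega : set 'rV[R]_d)
  (X : 'I_n -> 'rV[R]_d) (q a : R) : \bar R :=
  ereal_sup [set Linf_on Omega (fun x => (f x - interp Psi X f x) / CI_length Psi X q x)
            | f in [set f | (native_norm_on Psi Omega f <= a%:E)%E]].

Definition fill_distance {d n : nat} (Omega : set 'rV[R]_d) (X : 'I_n -> 'rV[R]_d) : \bar R :=
  ereal_sup [set (\big[Order.min/+oo%E]_(j < n) (enorm (x - X j))%:E)%E | x in Omega].

Definition sampling_scheme {d : nat} (Omega : set 'rV[R]_d)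
  (X : forall n : nat, 'I_n -> 'rV[R]_d) : Prop :=
  forall n, injective (X n) /\ forall j, Omega (X n j).

Definition fill_condition {d : nat} (Omega : set 'rV[R]_d)
  (X : forall n : nat, 'I_n -> 'rV[R]_d) (c1 c2 : R) : Prop :=
  forall n : nat, (0 < n)%N ->
    ((c1 * powR n%:R (- d%:R^-1))%:E <= fill_distance Omega (X n))%E /\
    (fill_distance Omega (X n) <= (c2 * powR n%:R (- d%:R^-1))%:E)%E.

End GPDefs.

(* Main.v *)
Require Import Defs.
From HB Require Import structures.
From mathcomp Require Import all_boot all_order all_algebra.
From mathcomp Require Import all_classical all_reals all_analysis.
From mathcomp Require Import measurable_realfun.
From mathcomp Require Import ring lra.
Set Implicit Arguments. Unset Strict Implicit. Unset Printing Implicit Defensive.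
Import Order.TTheory GRing.Theory Num.Def Num.Theory.
Import numFieldNormedType.Exports.
Local Open Scope classical_set_scope.
Local Open Scope ring_scope.

(** The Matern kernel is a Gaussian scale mixture:
    [Psi h = E (exp (- |h|^2 / (4 S)))] with [S] of law Gamma([nu - d/2]), and
    [S = exp x] turns this into an integral over the real line.  Exchanging
    integrals, the Fourier transform of [Psi] is an explicit positive integrable
    function, the inversion formula holds, and
    [sum_ij u_i u_j Psi (y_i - y_j) = c * int FPsi |sum_i u_i e^(i y_i.w)|^2 dw].
    The quadratic form is definite because Gaussian Gram matrices tend to the
    identity as their width tends to [0].

    For [F] in the native space, test its L2 Fourier transform against
    [e^(- s |w|^2) sum_i u_i e^(i y_i.w)]: by Cauchy-Schwarz and [s -> 0],
    [(sum_i u_i F y_i)^2 <= ||F||^2 sum_ij u_i u_j Psi (y_i - y_j)].  With the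
    kriging weights this is [|F x - interp F x| <= ||F|| sqrt (1 - r^T R^-1 r)],
    which is the upper bound.  Equality holds for the combination of kernels with
    these weights; it vanishes on the design, and by continuity its ratio exceeds
    half of the maximal value near any point of [Omega] outside the design.  Some
    such point has all its neighbourhoods of positive measure in [Omega], so
    [C = 1 / (4 q)] works. *)

(** * Integrals with a finite value *)

(** The native space gives access to the Fourier transform of [F] only through duality with real
    test functions lying in both L1 and L2. Neither Plancherel nor inversion can be applied to [F]
    itself, so trigonometric sums have to be damped before they are tested, and the damping is
    removed by a limit: a Gaussian approximate identity at a continuous L2 function. Real and
    imaginary parts are tested separately, so averages of [F] around [y i] and around [- y i] arise
    together, and the latter have to cancel.

    Integrals over R^d are given as iterated integrals, whereas domination and Fubini need a
    measure. Hence [tuple_lebesgue], a measure built by the same recursion as [iint]: every integral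
    is moved there, worked out, and moved back. *)

Section has_integral.
Context d (T : measurableType d) (R : realType) (mu : {measure set T -> \bar R}).
Implicit Types (f g : T -> R) (u v : R).

(** Carries integrability together with a real value, so that linearity, comparison and uniqueness
    take place in [R] and no finiteness condition on extended reals is left over. *)
Definition hasint f v :=
  mu.-integrable setT (EFin \o f) /\ (\int[mu]_x (f x)%:E = v%:E)%E.

Lemma hasint_measurable f v : hasint f v -> measurable_fun setT f.
Proof. by case=> /integrableP[/measurable_EFinP]. Qed.

Lemma hasintP f : mu.-integrable setT (EFin \o f) ->
  hasint f (fine (\int[mu]_x (f x)%:E)%E).
Proof. by move=> fi; split=> //; rewrite fineK//; exact: integrable_fin_num. Qed.

Lemma hasint_ge0P f v : measurable_fun setT f -> (forall x, 0 <= f x) ->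
  (\int[mu]_x (f x)%:E = v%:E)%E -> hasint f v.
Proof.
move=> mf f0 fv; split=> //; apply/integrableP; split; first exact/measurable_EFinP.
rewrite (eq_integral (fun x => (f x)%:E)) ?fv ?ltry// => x _ /=.
by rewrite ger0_norm.
Qed.

Lemma hasint_ext g f v : f =1 g -> hasint f v -> hasint g v.
Proof. by move=> /funext ->. Qed.

Lemma hasint_uniq f u v : hasint f u -> hasint f v -> u = v.
Proof. by move=> [_ fu] [_ fv]; apply/EFin_inj; rewrite -fu. Qed.

Lemma hasint0 : hasint (fun=> 0) 0.
Proof. by split; [exact: integrable0 | rewrite integral0]. Qed.

Lemma hasintD f g u v : hasint f u -> hasint g v ->
  hasint (fun x => f x + g x) (u + v).
Proof.
move=> [fi fu] [gi gv]; split.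
  by rewrite /comp; under eq_fun do rewrite EFinD; exact: integrableD.
by rewrite integralD_EFin// fu gv.
Qed.

Lemma hasintZ k f v : hasint f v -> hasint (fun x => k * f x) (k * v).
Proof.
move=> [fi fv]; split.
  by rewrite /comp; under eq_fun do rewrite EFinM; exact: integrableZl.
under eq_integral do rewrite EFinM.
by rewrite integralZl// fv.
Qed.

Lemma hasintB f g u v : hasint f u -> hasint g v ->
  hasint (fun x => f x - g x) (u - v).
Proof.
move=> fu /(hasintZ (-1)) gv; rewrite -mulN1r.
by apply: hasint_ext (hasintD fu gv) => x; rewrite mulN1r.
Qed.

Lemma hasint_sum (I : finType) (f : I -> T -> R) (v : I -> R) :
  (forall i, hasint (f i) (v i)) ->
  hasint (fun x => \sum_i f i x) (\sum_i v i).
Proof.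
move=> fv; have : hasint (fun x => \sum_(i <- enum I) f i x) (\sum_(i <- enum I) v i).
  elim: (enum I) => [|i s IH].
    by rewrite big_nil; apply: hasint_ext hasint0 => x; rewrite big_nil.
  rewrite big_cons; apply: hasint_ext (hasintD (fv i) IH) => x.
  by rewrite big_cons.
by rewrite big_enum/=; apply: hasint_ext => x; rewrite big_enum.
Qed.

Lemma hasint_le f g u v : hasint f u -> hasint g v -> (forall x, f x <= g x) -> u <= v.
Proof.
move=> [fi fu] [gi gv] fg; rewrite -lee_fin -fu -gv.
by apply: le_integral => // x _; rewrite lee_fin.
Qed.

Lemma hasint_ge0 f v : hasint f v -> (forall x, 0 <= f x) -> 0 <= v.
Proof. by move=> fv f0; apply: (hasint_le hasint0 fv). Qed.

Lemma dominated_hasint f g v : measurable_fun setT f -> hasint g v ->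
  (forall x, `|f x| <= g x) -> exists u, hasint f u.
Proof.
move=> mf [gi _] fg; exists (fine (\int[mu]_x (f x)%:E)%E); apply: hasintP.
apply: le_integrable gi => //; first exact/measurable_EFinP.
by move=> x _ /=; rewrite lee_fin (le_trans (fg x)) ?ler_norm.
Qed.

End has_integral.

(** * Product measures and exchange of integrals *)

Section fubini_hasint.
Context d1 d2 (T1 : measurableType d1) (T2 : measurableType d2) (R : realType).
Variables (m1 : {sigma_finite_measure set T1 -> \bar R})
          (m2 : {sigma_finite_measure set T2 -> \bar R}).

(** Each dimension adds a factor to a product, and Tonelli applies at the next one only if
    sigma-finiteness is inherited. The cover consists of rectangles enumerated by [pickle]. *)
Lemma sigma_finite_product : sigma_finite setT (m1 \x m2)%E.
Proof.
have [F TF Foo] := sigma_finiteT m1; have [G TG Goo] := sigma_finiteT m2.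
exists (fun k => if @unpickle (nat * nat)%type k is Some p then F p.1 `*` G p.2 else set0).
  apply/seteqP; split => // -[x y] _.
  have [i _ Fi] : (\bigcup_i F i) x by rewrite -TF.
  have [j _ Gj] : (\bigcup_j G j) y by rewrite -TG.
  by exists (pickle (i, j)) => //; rewrite pickleK.
move=> k; case: unpickle => [[i j]|]; last by rewrite measure0.
have [mF Fi] := Foo i; have [mG Gj] := Goo j; split; first exact: measurableX.
by rewrite product_measure1E// lte_mul_pinfty// ge0_fin_numE.
Qed.

(** Only the majorant [g] has to be integrated, and in one order: by Tonelli this makes [f]
    integrable for the product measure, and Fubini then identifies its two iterated integrals. *)
Lemma hasint_swap (f g : T1 -> T2 -> R) (G : T1 -> R) (F : T1 -> R) (H : T2 -> R) (w : R) :
  measurable_fun setT (fun z : T1 * T2 => f z.1 z.2) ->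
  measurable_fun setT (fun z : T1 * T2 => g z.1 z.2) ->
  (forall x y, `|f x y| <= g x y) ->
  (forall x, hasint m2 (g x) (G x)) -> hasint m1 G w ->
  (forall x, hasint m2 (f x) (F x)) ->
  (forall y, hasint m1 (f^~ y) (H y)) ->
  exists v, hasint m1 F v /\ hasint m2 H v.
Proof.
move=> mf mg fg gG Gw fF fH.
have g0 x y : 0 <= g x y by exact: le_trans (fg x y).
have fi : (m1 \x m2)%E.-integrable setT (fun z => (f z.1 z.2)%:E).
  apply/integrable12ltyP; first exact/measurable_EFinP.
  apply: (@le_lt_trans _ _ (\int[m1]_x (G x)%:E)%E); last by rewrite Gw.2 ltry.
  apply: ge0_le_integral => //=.
  - by move=> x _; apply: integral_ge0 => y _.
  - apply: (measurable_fun_fubini_tonelli_F (fun z => `|f z.1 z.2|%:E)) => //.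
    by apply/measurable_EFinP; apply: measurableT_comp.
  - by case: Gw => /integrableP[].
  move=> x _; rewrite -(gG x).2; apply: ge0_le_integral => //=.
  - apply/measurable_EFinP; apply: measurableT_comp => //.
    exact: hasint_measurable (fF x).
  - by apply/measurable_EFinP; exact: hasint_measurable (gG x).
  - by move=> y _; rewrite lee_fin.
have FE : fubini_F m2 (fun z => (f z.1 z.2)%:E) = EFin \o F.
  by apply/funext => x; rewrite /fubini_F/= (fF x).2.
have HE : fubini_G m1 (fun z => (f z.1 z.2)%:E) = EFin \o H.
  by apply/funext => x; rewrite /fubini_G/= (fH x).2.
have Fi : m1.-integrable setT (EFin \o F) by rewrite -FE; exact: (integrable_fubini_F fi).
have Hm : measurable_fun setT (EFin \o H) by rewrite -HE; exact: (measurable_fubini_G fi).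
have IF := integral12_prod_meas1 fi; rewrite FE in IF.
have IH := integral21_prod_meas1 fi; rewrite HE in IH.
exists (fine (\int[m1]_x (F x)%:E)%E); split; first exact: hasintP.
split; last first.
  by rewrite fineK ?integrable_fin_num// -[RHS]/(\int[m1]_x (EFin \o F) x)%E IF -IH.
apply/integrableP; split => //.
apply: (@le_lt_trans _ _ (\int[m2]_y \int[m1]_x `|f x y|%:E)%E); last first.
  exact: (integrable21ltyP _ _ (measurable_int _ fi)).1.
apply: ge0_le_integral => //=.
- by apply/measurable_EFinP; apply: measurableT_comp => //; exact/measurable_EFinP.
- apply: (measurable_fun_fubini_tonelli_G (fun z => `|f z.1 z.2|%:E)) => //.
  by apply/measurable_EFinP; apply: measurableT_comp.
move=> y _; have := le_abse_integral m1 measurableT (measurable_int _ (fH y).1).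
by rewrite (fH y).2/=.
Qed.

End fubini_hasint.

(** * Lebesgue measure on tuples *)

Section lebesgue_tuple.
Variable R : realType.

(* [measurableTypeR R] is the carrier of [lebesgue_measure]; its measurable sets are
   those of [R], but under another display. *)
Definition tcons n (z : measurableTypeR R * n.-tuple R) : n.+1.-tuple R := [tuple of z.1 :: z.2].
Definition tuncons n (t : n.+1.-tuple R) : measurableTypeR R * n.-tuple R :=
  (thead t, [tuple of behead t]).

Lemma tconsK n : cancel (@tcons n) (@tuncons n).
Proof. by case=> a t; congr pair; apply: val_inj. Qed.

Lemma measurable_tcons n : measurable_fun setT (@tcons n).
Proof. by apply: measurable_cons. Qed.

Lemma measurable_tuncons n : measurable_fun setT (@tuncons n).
Proof.
apply/measurable_fun_pairP; split; last exact: measurable_behead.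
exact: measurable_tnth.
Qed.

Section cons_measure.
Variables (n : nat) (m : {sigma_finite_measure set (n.-tuple R) -> \bar R}).

(** One step of the recursion [iint] as a measure: the first coordinate is split off. *)
Definition cons_measure : set (n.+1.-tuple R) -> \bar R :=
  pushforward (@lebesgue_measure R \x m)%E (@tcons n).

Let cons_measure0 : cons_measure set0 = 0%E.
Proof. by rewrite /cons_measure /pushforward preimage_set0 measure0. Qed.

Let cons_measure_ge0 A : (0 <= cons_measure A)%E.
Proof. by rewrite /cons_measure /pushforward; exact: measure_ge0. Qed.

Let cons_measure_sigma_additive : semi_sigma_additive cons_measure.
Proof.
apply: (@measure_semi_sigma_additive _ _ _ (pushforward (@lebesgue_measure R \x m)%E (@tcons n))).
exact: measurable_tcons.
Qed.

HB.instance Definition _ := isMeasure.Build _ _ _ cons_measure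
  cons_measure0 cons_measure_ge0 cons_measure_sigma_additive.

Let cons_measure_sigma_finite : sigma_finite setT cons_measure.
Proof.
have [F FT Fm] := sigma_finite_product (@lebesgue_measure R) m.
exists (fun i => @tuncons n @^-1` F i).
  apply/seteqP; split => // t _; have : [set: measurableTypeR R * n.-tuple R] (tuncons t) by [].
  by rewrite FT => -[i _ Fi]; exists i.
move=> i; split.
  by rewrite -[X in measurable X]setTI; apply: measurable_tuncons => //; exact: (Fm i).1.
rewrite /cons_measure /pushforward -comp_preimage.
rewrite (_ : _ \o _ = id); last by apply/funext => z; exact: tconsK.
exact: (Fm i).2.
Qed.
HB.instance Definition _ := @Measure_isSigmaFinite.Build _ _ _ cons_measure
  cons_measure_sigma_finite.

Lemma cons_measure_tonelli (f : n.+1.-tuple R -> \bar R) :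
  measurable_fun setT f -> (forall t, 0 <= f t)%E ->
  (\int[cons_measure]_t f t =
   \int[@lebesgue_measure R]_a \int[m]_t f (tcons (a, t)))%E.
Proof.
move=> mf f0.
rewrite (ge0_integral_pushforward (@measurable_tcons n)) ?preimage_setT//.
rewrite (fubini_tonelli1 (f \o @tcons n))//; last by move=> z; exact: f0.
exact: (measurableT_comp mf (@measurable_tcons n)).
Qed.

(** For a signed [f]: the iterated integral of the majorant [g] is its integral by Tonelli, so [f]
    is integrable, and by Fubini the iterated value [v] is its integral. *)
Lemma hasint_cons_measure (f g : n.+1.-tuple R -> R) (F G : R -> R) (v w : R) :
  measurable_fun setT f -> measurable_fun setT g ->
  (forall t, `|f t| <= g t) ->
  (forall a, hasint m (fun t => g (tcons (a, t))) (G a)) ->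
  hasint (@lebesgue_measure R) G w ->
  (forall a, hasint m (fun t => f (tcons (a, t))) (F a)) ->
  hasint (@lebesgue_measure R) F v ->
  hasint cons_measure f v.
Proof.
move=> mf mg fg gG Gw fF Fv.
have g0 t : 0 <= g t by exact: le_trans (fg t).
have gw : hasint cons_measure g w.
  apply: hasint_ge0P => //; rewrite cons_measure_tonelli//; first last.
  - exact/measurable_EFinP.
  by rewrite -Gw.2; apply: eq_integral => a _; rewrite (gG a).2.
have [u fu] := dominated_hasint mf gw fg.
suff -> : v = u by [].
apply/EFin_inj; rewrite -fu.2 -Fv.2.
have fi : (@lebesgue_measure R \x m)%E.-integrable setT (EFin \o f \o @tcons n).
  apply/integrableP; split.
    apply/measurable_EFinP; exact: (measurableT_comp mf (@measurable_tcons n)).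
  case/integrableP : fu.1 => /= _.
  rewrite (ge0_integral_pushforward (@measurable_tcons n)) ?preimage_setT//.
  by apply/measurable_EFinP; apply: measurableT_comp.
rewrite (@integral_pushforward _ _ _ _ _ _ (@measurable_tcons n)) ?preimage_setT//.
  rewrite -(integral12_prod_meas1 fi).
  by apply: eq_integral => a _; rewrite /fubini_F/= (fF a).2.
exact/measurable_EFinP.
Qed.

End cons_measure.

(** The unit mass at the empty tuple mirrors the value [f 0] of [iint] in dimension 0. *)
Fixpoint tuple_lebesgue n : {sigma_finite_measure set (n.-tuple R) -> \bar R} :=
  match n with
  | 0%N => (@dirac _ _ ([tuple] : 0.-tuple R) R : {sigma_finite_measure set _ -> \bar R})
  | n'.+1 => (cons_measure (tuple_lebesgue n') : {sigma_finite_measure set _ -> \bar R})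
  end.

Definition rowt n (t : n.-tuple R) : 'rV[R]_n := \row_i tnth t i.

Lemma rowt_cons n (a : R) (t : n.-tuple R) :
  rowt (tcons (a, t)) = row_mx (a%:M : 'M[R]_1) (rowt t).
Proof.
apply/rowP => i; rewrite !mxE; case: splitP => j.
  by rewrite [j]ord1 => /= i0; rewrite (_ : i = ord0) ?mxE ?mulr1n //; apply: val_inj.
move=> ij; rewrite mxE (_ : i = lift ord0 j) ?tnthS//.
by apply: val_inj; rewrite /= ij.
Qed.

Lemma rowtP n (x : 'rV[R]_n) : exists t, rowt t = x.
Proof. by exists [tuple x 0 i | i < n]; apply/rowP => i; rewrite mxE tnth_mktuple. Qed.

Lemma iint_tuple n (g : 'rV[R]_n -> \bar R) :
  measurable_fun setT (g \o @rowt n) -> (forall x, 0 <= g x)%E ->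
  iint g = (\int[tuple_lebesgue n]_t g (rowt t))%E.
Proof.
elim: n g => [|n IH] g mg g0 /=.
  rewrite integral_dirac// diracE in_setT mul1e; congr g.
  by apply/rowP => -[].
rewrite cons_measure_tonelli//.
have mc a : measurable_fun setT (fun t : n.-tuple R => tcons (a, t)).
  exact: (@measurable_cons _ _ _ _ (cst a) n id).
apply: eq_integral => a _; rewrite IH//.
  by apply: eq_integral => t _; rewrite rowt_cons.
rewrite (_ : _ \o _ = g \o @rowt n.+1 \o (fun t => tcons (a, t))).
  exact: measurableT_comp.
by apply/funext => t /=; rewrite rowt_cons.
Qed.

End lebesgue_tuple.

(** * The Fourier transform of a Gaussian *)

Section real_line.
Variable R : realType.
Let mu := @lebesgue_measure R.
Implicit Types (f F : R -> R) (v x : R).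

Lemma is_derive_continuous F f : (forall x, is_derive x 1 F (f x)) -> continuous F.
Proof.
by move=> dF x; apply/differentiable_continuous/derivable1_diffP; case: (dF x).
Qed.

Lemma hasint_affine f v (c y : R) : continuous f -> 0 < c -> hasint mu f v ->
  hasint mu (fun x => f ((x - y) * c)) (c^-1 * v).
Proof.
move=> cf c0 fv.
pose A (x : R) := (x - y) * c.
have dA x : is_derive x 1 A c.
  rewrite /A; apply: is_derive_eq; rewrite oppr0 addr0.
  by rewrite scaler0 add0r [c%:A]mulr1.
have A'E : derive1 A = cst c by apply/funext => x; rewrite derive1E; exact: derive_val.
(* The substitution rule is applied to nonnegative functions; a signed [f] is recovered at the end
   as [(f + |f|) - |f|]. *)
have pos (g : R -> R) w : continuous g -> (forall x, 0 <= g x) -> hasint mu g w ->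
    hasint mu (fun x => g (A x)) (c^-1 * w).
  move=> cg g0 gw.
  have cA := is_derive_continuous dA.
  have mgA : measurable_fun setT (fun x => g (A x)).
    apply: continuous_measurable_fun => x.
    by apply: (@continuous_comp _ _ _ A g); [exact: cA | exact: cg].
  apply: hasint_ge0P => //.
  have [gi gE] := gw; rewrite EFinM -gE.
  rewrite (@increasing_ge0_integration_by_substitutionT R A g)//.
  - rewrite A'E -ge0_integralZl//.
    + apply: eq_integral => x _; rewrite -EFinM fctE/= mulrC.
      by rewrite mulfK// gt_eqF.
    + apply/measurable_EFinP; apply: measurable_funM => //.
    + by move=> x _; rewrite lee_fin mulr_ge0//= ltW.
    + by rewrite lee_fin invr_ge0 ltW.
  - by move=> x z xz; rewrite /A ltr_pM2r// ltrD2r.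
  - by rewrite A'E; exact: cst_continuous.
  - by rewrite A'E; exact: is_cvg_cst.
  - by rewrite A'E; exact: is_cvg_cst.
  - by apply/gt0_cvgMlNy => //; exact: cvg_addrr_Ny.
  - by apply/gt0_cvgMly => //; exact: cvg_addrr.
have mf := hasint_measurable fv.
have [w nfw] : exists w, hasint mu (fun x => `|f x|) w.
  by have /integrable_norm/hasintP H := fv.1; eexists; exact: H.
have cn : continuous (fun x => `|f x|).
  by move=> x; apply: (@continuous_comp _ _ _ f); [exact: cf|exact: norm_continuous].
have H1 : hasint mu (fun x => `|f (A x)|) (c^-1 * w) by apply: (pos (fun x => `|f x|)).
have H2 : hasint mu (fun x => f (A x) + `|f (A x)|) (c^-1 * (v + w)).
  apply: (pos (fun x => f x + `|f x|)).
  - by move=> x; apply: cvgD; [exact: cf|exact: cn].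
  - by move=> x; rewrite -lerBlDl sub0r -normrN ler_norm.
  - exact: hasintD.
have := hasintB H2 H1; rewrite -mulrBr addrK.
by apply: hasint_ext => x; rewrite addrK.
Qed.

Lemma hasint_gauss : hasint mu gauss_fun (Num.sqrt pi).
Proof. by split; [exact: integrableT_gauss | exact: integralT_gauss]. Qed.

(** The fundamental theorem of calculus on growing symmetric intervals, then dominated convergence.
    The bounds are [n.+1] so that the first interval is not reduced to a point. *)
Lemma hasint_derivative F f : (forall x, is_derive x 1 F (f x)) -> continuous f ->
  mu.-integrable setT (EFin \o f) ->
  F n.+1%:R - F (- n.+1%:R) @[n --> \oo] --> 0 ->
  hasint mu f 0.
Proof.
move=> dF cf fi F0; split => //.
have cF := is_derive_continuous dF.
pose g n := (EFin \o f) \_ `[- n.+1%:R, n.+1%:R].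
have gn n : (\int[mu]_x g n x = (F n.+1%:R - F (- n.+1%:R))%:E)%E.
  rewrite -integral_mkcond EFinB; apply: continuous_FTC2.
  - by rewrite (@lt_trans _ _ 0)// oppr_lt0.
  - exact: continuous_subspaceT.
  - split; first by move=> x _; case: (dF x).
    + by apply: cvg_at_right_filter; exact: cF.
    + by apply: cvg_at_left_filter; exact: cF.
  - by move=> x _; rewrite derive1E; exact: derive_val.
have mg n : measurable_fun setT (g n).
  apply/(measurable_restrictT _ _).1 => //.
  by apply: measurable_funTS; exact: measurable_int fi.
have gf : {ae mu, forall x, setT x -> g n x @[n --> \oo] --> (f x)%:E}.
  apply/aeW => x _; apply: cvg_near_cst; near=> n.
  rewrite /g patchE mem_set//= in_itv/= -ler_norml.
  by apply: ltW; apply: lt_trans (_ : n%:R < _); [near: n; exact: nbhs_infty_gtr | rewrite ltr_nat].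
have gle : {ae mu, forall x n, setT x -> (`|g n x| <= `|(f x)%:E|)%E}.
  by apply/aeW => x n _; rewrite /g patchE; case: ifP => // _; rewrite abse0 abse_ge0.
have [_ _] := @dominated_convergence _ _ _ mu setT measurableT g _ _ mg
   (measurable_int _ fi) gf (integrable_abse fi) gle.
rewrite (_ : (fun n => _) = (fun n => (F n.+1%:R - F (- n.+1%:R))%:E)); last first.
  by apply/funext => n; rewrite gn.
move=> H; apply: (cvg_unique _ H); first exact: ereal_hausdorff.
by apply: cvg_EFin F0; exact: nearW.
Unshelve. all: by end_near. Qed.

(** Since [|x| <= 1 + x^2 / 2 <= expR (x^2 / 2)], the rescaled Gaussian [expR (- x^2 / 2)] is a
    majorant. The lemma provides the domination needed to differentiate a Gaussian integral in its
    frequency. *)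
Lemma hasint_id_gauss : exists v, hasint mu (fun x => `|x| * gauss_fun x) v.
Proof.
have s0 : 0 < (Num.sqrt 2)^-1 :> R by rewrite invr_gt0 sqrtr_gt0.
have H := hasint_affine 0 (@continuous_gauss_fun R) s0 hasint_gauss.
apply: dominated_hasint H _.
  by apply: measurable_funM => //; exact: measurable_gauss_fun.
move=> x; rewrite normrM normr_id (ger0_norm (gauss_fun_ge0 _)).
rewrite /gauss_fun subr0 exprMn exprVn sqr_sqrtr//.
have -> : - x ^+ 2 = - (x ^+ 2 / 2) + - (x ^+ 2 / 2) by field.
rewrite expRD mulrA ler_piMl ?expR_ge0// expRN ler_pdivrMr ?expR_gt0// mul1r.
apply: le_trans (expR_ge1Dx _).
have : 0 <= (`|x| - 1) ^+ 2 by exact: sqr_ge0.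
rewrite -(real_normK (num_real x)); nra.
Qed.

Lemma gauss_natr_cvg0 : gauss_fun (n.+1%:R : R) @[n --> \oo] --> (0 : R).
Proof.
have := (cvg_pinftyP (@gauss_fun R) 0).1 (@cvg_gauss_fun R) (fun n => n.+1%:R).
apply; apply/cvgryPge => A; near=> n.
apply: ltW; apply: lt_trans (_ : n%:R < _); last by rewrite ltr_nat.
by near: n; exact: nbhs_infty_gtr.
Unshelve. all: by end_near. Qed.

Lemma is_derive_gauss x : is_derive x 1 (@gauss_fun R) (- 2 * x * gauss_fun x).
Proof.
have H : is_derive x 1 (fun x : R => - x ^+ 2) (- (2 * x)).
  by apply: is_derive_eq; rewrite [x%:A]mulr1; ring.
have := @is_derive1_comp _ expR _ x _ _ (is_derive_expR _) H.
by move/is_derive_eq; apply; rewrite /gauss_fun; ring.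
Qed.

Lemma is_derive_phase (a b x : R) : is_derive x 1 (fun x => x * a + b) a.
Proof. by apply: is_derive_eq; rewrite addr0 scaler0 add0r [_ *: _]mulr1. Qed.

Lemma is_derive_sin_phase (a b x : R) :
  is_derive x 1 (fun x => sin (x * a + b)) (cos (x * a + b) * a).
Proof. exact: (@is_derive1_comp _ sin _ x _ _ (is_derive_sin _) (is_derive_phase a b x)). Qed.

Lemma is_derive_cos_phase (a b x : R) :
  is_derive x 1 (fun x => cos (x * a + b)) (- sin (x * a + b) * a).
Proof. exact: (@is_derive1_comp _ cos _ x _ _ (is_derive_cos _) (is_derive_phase a b x)). Qed.

Lemma continuous_cos_phase (a b : R) : continuous (fun x => cos (x * a + b)).
Proof. exact: is_derive_continuous (is_derive_cos_phase a b). Qed.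

Lemma continuous_sin_phase (a b : R) : continuous (fun x => sin (x * a + b)).
Proof. exact: is_derive_continuous (is_derive_sin_phase a b). Qed.

Lemma normr_cos_le1 x : `|cos x| <= 1.
Proof. by rewrite ler_norml cos_le1 cos_geN1. Qed.

Lemma normr_sin_le1 x : `|sin x| <= 1.
Proof. by rewrite ler_norml sin_le1 sin_geN1. Qed.

Section gauss_fourier.
Variable th : R.

Let f (w z : R) := gauss_fun z * cos (z * w + th).

Let cf w : continuous (f w).
Proof.
by move=> x; apply: cvgM; [exact: continuous_gauss_fun | exact: continuous_cos_phase].
Qed.

Let fi w : exists v, hasint mu (f w) v.
Proof.
apply: dominated_hasint hasint_gauss _; first exact: continuous_measurable_fun.
move=> x; rewrite normrM ger0_norm ?gauss_fun_ge0// ler_piMr ?gauss_fun_ge0//.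
exact: normr_cos_le1.
Qed.

Let H w := fine (\int[mu]_z (f w z)%:E)%E.

Let HE w : hasint mu (f w) (H w).
Proof. by have [v []] := fi w; rewrite /H => + _; exact: hasintP. Qed.

Let g (w z : R) := z * gauss_fun z * sin (z * w + th).

Let cg w : continuous (g w).
Proof.
move=> x; apply: cvgM; [|exact: continuous_sin_phase].
by apply: cvgM; [exact: cvg_id | exact: continuous_gauss_fun].
Qed.

(** Integration by parts: the derivative of [gauss_fun z * sin (z * w + th)] in [z] is
    [- 2 * g w z + w * f w z], and its integral is 0. *)
Let hasint_g w : hasint mu (g w) (w / 2 * H w).
Proof.
have [b Hb] := hasint_id_gauss.
have [v gv] : exists v, hasint mu (g w) v.
  apply: dominated_hasint Hb _; first exact: continuous_measurable_fun.
  move=> x; rewrite !normrM (ger0_norm (gauss_fun_ge0 _)) ler_piMr//.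
    by rewrite mulr_ge0 ?gauss_fun_ge0.
  exact: normr_sin_le1.
have Hs := hasintD (hasintZ (- 2) gv) (hasintZ w (HE w)).
have [_ Hs0] : hasint mu (fun x => - 2 * g w x + w * f w x) 0.
  apply: (@hasint_derivative (fun x => gauss_fun x * sin (x * w + th))).
  - move=> x; have := is_deriveM (is_derive_gauss x) (is_derive_sin_phase w th x).
    move/is_derive_eq; apply; rewrite /f /g.
    by rewrite ![_ *: _]mulrC /=; ring.
  - move=> x; apply: cvgD; (apply: cvgM; first exact: cvg_cst); [exact: cg|exact: cf].
  - exact: Hs.1.
  - apply/cvgr0Pnorm_lt => e e0.
    have /cvgr0Pnorm_lt/(_ (e / 2)) := gauss_natr_cvg0.
    rewrite divr_gt0// => /(_ isT); apply: filterS => n.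
    rewrite ger0_norm ?gauss_fun_ge0// => he.
    apply: le_lt_trans (ler_normB _ _) _; rewrite !normrM.
    rewrite !(ger0_norm (gauss_fun_ge0 _)) {2}/gauss_fun sqrrN -/(gauss_fun _).
    rewrite (splitr e); apply: ltrD; apply: le_lt_trans he;
      by rewrite ler_piMr ?gauss_fun_ge0 ?normr_sin_le1.
have := hasint_uniq Hs (conj Hs.1 Hs0) => E.
suff -> : w / 2 * H w = v by [].
by apply: (mulfI (_ : 2 != 0 :> R)) => //; lra.
Qed.

(** Differentiation under the integral produces minus the integral of [g w], which [hasint_g]
    expresses through [H] again: a linear differential equation. *)
Let dH (w : R) : is_derive w (1 : R) H (- (w / 2 * H w)).
Proof.
have [b Hb] := hasint_id_gauss.
have Ia : (`]w - 1, w + 1[ : set R)%classic w.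
  by rewrite /= in_itv/= ltrBlDr ltrDl ltr01.
have df x y : is_derive x 1 (f^~ y) (- g x y).
  rewrite /f; under eq_fun do rewrite (mulrC y).
  have := is_deriveZ (gauss_fun y) (is_derive_cos_phase y th x).
  by move/is_derive_eq; apply; rewrite /g [_ *: _]mulrC (mulrC x); ring.
have d1E x y : partial1of2 f x y = - g x y.
  by rewrite partial1of2E; exact: derive_val.
have intf x : mu.-integrable setT (EFin \o f x) by exact: (HE x).1.
have G0 (y : R) : 0 <= `|y| * gauss_fun y by rewrite mulr_ge0 ?gauss_fun_ge0.
have Gub (x y : R) : `|partial1of2 f x y| <= `|y| * gauss_fun y.
  rewrite d1E normrN !normrM (ger0_norm (gauss_fun_ge0 _)) ler_piMr//.
  exact: normr_sin_le1.
have derf (x y : R) : derivable (f^~ y) x 1 by case: (df x y).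
apply: DeriveDef.
  exact: (@derivable_under_integral R _ _ mu f setT measurableT w _ _ Ia (fun x _ => intf x)
    (fun x y _ _ => derf x y) _ G0 Hb.1 (fun x y _ _ => Gub x y)).
rewrite -derive1E (@differentiation_under_integral R _ _ mu f setT measurableT w _ _ Ia
    (fun x _ => intf x) (fun x y _ _ => derf x y) _ G0 Hb.1 (fun x y _ _ => Gub x y)).
have [_ E] := hasintZ (-1) (hasint_g w).
transitivity (fine (\int[mu]_z (-1 * g w z)%:E)%E); last by rewrite E/= mulN1r.
by congr fine; apply: eq_integral => z _; rewrite d1E mulN1r.
Qed.

(** By the differential equation, [H w * expR (w^2 / 4)] has derivative 0; its value at 0 is the
    Gaussian integral times [cos th]. *)
Lemma hasint_gauss_cos w :
  hasint mu (fun z => gauss_fun z * cos (z * w + th))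
    (Num.sqrt pi * expR (- (w ^+ 2 / 4)) * cos th).
Proof.
suff <- : H w = Num.sqrt pi * expR (- (w ^+ 2 / 4)) * cos th by exact: HE.
have dE x : is_derive x 1 (fun w => expR (w ^+ 2 / 4)) (x / 2 * expR (x ^+ 2 / 4)).
  have dq : is_derive x 1 (fun w : R => w ^+ 2 / 4) (x / 2).
    by apply: is_derive_eq; rewrite !scaler0 add0r [x%:A]mulr1 [_ *: _]mulrC; field.
  have := @is_derive1_comp _ expR _ x _ _ (is_derive_expR _) dq.
  by move/is_derive_eq; apply; rewrite mulrC.
have dP x : is_derive x 1 (fun w => H w * expR (w ^+ 2 / 4)) 0.
  have := is_deriveM (dH x) (dE x); move/is_derive_eq; apply.
  by rewrite ![_ *: _]mulrC /=; ring.
have := is_derive_0_is_cst w 0 dP.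
rewrite expr0n/= mul0r expR0 mulr1 => E.
have H0 : H 0 = cos th * Num.sqrt pi.
  apply: hasint_uniq (HE 0) _; apply: hasint_ext (hasintZ (cos th) hasint_gauss) => z.
  by rewrite /f mulr0 add0r mulrC.
rewrite expRN -[LHS](@mulfK _ (expR (w ^+ 2 / 4))) ?gt_eqF ?expR_gt0// E H0.
by ring.
Qed.

End gauss_fourier.

Lemma hasint_gauss_fourier1 (s y w th : R) : 0 < s ->
  hasint mu (fun x => expR (- ((x - y) ^+ 2 / (4 * s))) * cos (x * w + th))
    (Num.sqrt (4 * pi * s) * expR (- (s * w ^+ 2)) * cos (y * w + th)).
Proof.
move=> s0; have s4 : 0 < 4 * s by rewrite mulr_gt0.
set r := Num.sqrt (4 * s).
have r0 : 0 < r by rewrite sqrtr_gt0.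
have r2 : r ^+ 2 = 4 * s by rewrite sqr_sqrtr// ltW.
have ri0 : 0 < r^-1 by rewrite invr_gt0.
have Hc : continuous (fun z : R => gauss_fun z * cos (z * (r * w) + (y * w + th))).
  by move=> z; apply: cvgM; [exact: continuous_gauss_fun | exact: continuous_cos_phase].
have := hasint_affine y Hc ri0 (hasint_gauss_cos (y * w + th) (r * w)).
rewrite invrK => Hh.
have E : r * (Num.sqrt pi * expR (- ((r * w) ^+ 2 / 4)) * cos (y * w + th)) =
    Num.sqrt (4 * pi * s) * expR (- (s * w ^+ 2)) * cos (y * w + th).
  rewrite (_ : 4 * pi * s = (4 * s) * pi); last by ring.
  rewrite sqrtrM ?(ltW s4)// -/r exprMn r2 !mulrA; congr (_ * expR _ * _).
  by field.
rewrite E in Hh; apply: hasint_ext Hh => x; congr (_ * cos _).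
  by rewrite /gauss_fun exprMn exprVn r2.
by field; rewrite gt_eqF.
Qed.

End real_line.

(** * Gaussian Fourier transforms in any dimension *)

Section gauss_tuple.
Variable R : realType.
Local Notation leb := (@tuple_lebesgue R).

Definition sqn n (x : 'rV[R]_n) : R := \sum_i x 0 i ^+ 2.

Lemma sqn_ge0 n (x : 'rV[R]_n) : 0 <= sqn x.
Proof. by apply: sumr_ge0 => i _; exact: sqr_ge0. Qed.

Lemma sqn0 n : sqn (0 : 'rV[R]_n) = 0.
Proof. by rewrite /sqn big1// => i _; rewrite mxE expr0n. Qed.

Lemma sqnN n (x : 'rV[R]_n) : sqn (- x) = sqn x.
Proof. by apply: eq_bigr => i _; rewrite mxE sqrrN. Qed.

Lemma sqn_eq0 n (x : 'rV[R]_n) : (sqn x == 0) = (x == 0).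
Proof.
apply/eqP/eqP => [/psumr_eq0P x0|->]; last exact: sqn0.
apply/rowP => i; apply/eqP; rewrite mxE -sqrf_eq0; apply/eqP.
by apply: x0 => // j _; exact: sqr_ge0.
Qed.

Lemma dotp0r n (x : 'rV[R]_n) : dotp x 0 = 0.
Proof. by rewrite /dotp big1// => i _; rewrite mxE mulr0. Qed.

Lemma dotp0l n (x : 'rV[R]_n) : dotp 0 x = 0.
Proof. by rewrite /dotp big1// => i _; rewrite mxE mul0r. Qed.

Lemma dotpC n (x y : 'rV[R]_n) : dotp x y = dotp y x.
Proof. by apply: eq_bigr => i _; rewrite mulrC. Qed.

Lemma dotpBl n (x y w : 'rV[R]_n) : dotp (x - y) w = dotp x w - dotp y w.
Proof. by rewrite /dotp -sumrB; apply: eq_bigr => i _; rewrite !mxE mulrBl. Qed.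

(* The free phase [th] makes the induction on the dimension go through without
   splitting cosines of sums. *)
Lemma hasint_gauss_fourier n (s : R) (y w : 'I_n -> R) (th : R) : 0 < s ->
  hasint (leb n) (fun t => expR (- (\sum_i (tnth t i - y i) ^+ 2 / (4 * s))) *
                      cos (\sum_i tnth t i * w i + th))
    (Num.sqrt (4 * pi * s) ^+ n * expR (- (s * \sum_i w i ^+ 2)) *
     cos (\sum_i y i * w i + th)).
Proof.
move=> s0; elim: n y w th => [|n IH] y w th.
  rewrite !big_ord0 mulr0 oppr0 expR0 expr0 !mul1r add0r.
  apply: (@hasint_ext _ _ _ _ _ (fun=> cos th)).
    by move=> t; rewrite !big_ord0 oppr0 expR0 mul1r add0r.
  split; first exact: finite_measure_integrable_cst.
  by rewrite integral_dirac// diracE in_setT mul1e.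
have mE k (z : 'I_k -> R) :
    measurable_fun setT (fun t : k.-tuple R => expR (- (\sum_i (tnth t i - z i) ^+ 2 / (4 * s)))).
  apply: measurableT_comp => //; apply: measurableT_comp => //.
  apply: measurable_sum => i; apply: measurable_funM => //.
  by apply: measurable_funX; apply: measurable_funB => //; exact: measurable_tnth.
have mC k (z : 'I_k -> R) b :
    measurable_fun setT (fun t : k.-tuple R => cos (\sum_i tnth t i * z i + b)).
  apply: measurableT_comp; first by apply: continuous_measurable_fun; exact: continuous_cos.
  apply: measurable_funD => //.
  by apply: measurable_sum => i; apply: measurable_funM => //; exact: measurable_tnth.
pose g (t : n.+1.-tuple R) := expR (- (\sum_i (tnth t i - y i) ^+ 2 / (4 * s))).
pose y' i := y (lift ord0 i); pose w' i := w (lift ord0 i).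
have gE a t : g (tcons (a, t)) = expR (- ((a - y ord0) ^+ 2 / (4 * s))) *
   expR (- (\sum_i (tnth t i - y' i) ^+ 2 / (4 * s))).
  rewrite /g big_ord_recl -expRD -opprD; congr (expR (- (_ + _))).
  by apply: eq_bigr => i _; rewrite tnthS.
have cE a t b : \sum_i tnth (tcons (a, t)) i * w i + b =
    \sum_i tnth t i * w' i + (a * w ord0 + b).
  rewrite big_ord_recl addrAC addrC; congr (_ + _).
  by apply: eq_bigr => i _; rewrite tnthS.
(* At frequency and phase 0 the cosine is 1: this is the integral of the Gaussian alone, which
   serves as majorant. *)
have IHg := IH y' (fun=> 0) 0; rewrite /= in IHg.
have z0 (k : nat) (z : 'I_k -> R) : \sum_i z i * 0 = 0.
  by rewrite big1// => i _; rewrite mulr0.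
have z1 (k : nat) : \sum_(i < k) (0 : R) ^+ 2 = 0.
  by rewrite big1// => i _; rewrite expr0n.
have G1 := hasint_gauss_fourier1 (y ord0) 0 0 s0.
have F1 := hasint_gauss_fourier1 (y ord0) (w ord0) (\sum_i y' i * w' i + th) s0.
set c := Num.sqrt (4 * pi * s) in IHg G1 F1 *.
apply: (@hasint_cons_measure _ _ _ _ g
  (fun a => expR (- ((a - y ord0) ^+ 2 / (4 * s))) *
    (c ^+ n * expR (- (s * \sum_i w' i ^+ 2)) * cos (\sum_i y' i * w' i + (a * w ord0 + th))))
  (fun a => expR (- ((a - y ord0) ^+ 2 / (4 * s))) * c ^+ n) _ (c ^+ n * c)).
- by apply: measurable_funM; [exact: mE | exact: mC].
- exact: mE.
- move=> t; rewrite normrM (ger0_norm (expR_ge0 _)) ler_piMr ?expR_ge0//.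
  exact: normr_cos_le1.
- move=> a; have := hasintZ (expR (- ((a - y ord0) ^+ 2 / (4 * s)))) IHg.
  rewrite (z1 n) !z0 mulr0 oppr0 expR0 mulr1 addr0 cos0 mulr1.
  by apply: hasint_ext => t; rewrite gE z0 addr0 cos0 mulr1.
- have := hasintZ (c ^+ n) G1.
  rewrite expr0n/= !mulr0 oppr0 expR0 addr0 cos0 !mulr1.
  by apply: hasint_ext => a; rewrite mulr0 addr0 cos0 mulr1 mulrC.
- move=> a; have := hasintZ (expR (- ((a - y ord0) ^+ 2 / (4 * s)))) (IH y' w' (a * w ord0 + th)).
  by apply: hasint_ext => t; rewrite cE mulrA -gE.
- have := hasintZ (c ^+ n * expR (- (s * \sum_i w' i ^+ 2))) F1.
  rewrite (_ : _ * (_ * _) = c ^+ n.+1 * expR (- (s * \sum_i w i ^+ 2)) *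
     cos (\sum_i y i * w i + th)).
    apply: hasint_ext => a /=.
    by rewrite (addrCA (a * w ord0)); ring.
  rewrite !big_ord_recl/= (exprSr c) mulrDr opprD expRD.
  by rewrite -(addrA (y ord0 * w ord0)) /y' /w'; ring.
Qed.

Lemma hasint_gauss_row n (s : R) (y w : 'rV[R]_n) (th : R) : 0 < s ->
  hasint (leb n) (fun t => expR (- (sqn (rowt t - y) / (4 * s))) * cos (dotp (rowt t) w + th))
    (Num.sqrt (4 * pi * s) ^+ n * expR (- (s * sqn w)) * cos (dotp y w + th)).
Proof.
move=> s0; apply: hasint_ext (hasint_gauss_fourier (y 0) (w 0) th s0) => t.
congr (expR (- _) * cos (_ + _)).
  by rewrite /sqn mulr_suml; apply: eq_bigr => i _; rewrite !mxE.
by apply: eq_bigr => i _; rewrite mxE.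
Qed.

Lemma measurable_sqn n (y : 'rV[R]_n) : measurable_fun setT (fun t => sqn (rowt t - y)).
Proof.
apply: measurable_sum => i; apply: measurable_funX.
under eq_fun do rewrite !mxE.
by apply: measurable_funB => //; exact: measurable_tnth.
Qed.

Lemma measurable_dotp n (w : 'rV[R]_n) : measurable_fun setT (fun t => dotp (rowt t) w).
Proof.
apply: measurable_sum => i; under eq_fun do rewrite !mxE.
by apply: measurable_funM => //; exact: measurable_tnth.
Qed.

Lemma measurable_cos_phase n (w : 'rV[R]_n) (th : R) :
  measurable_fun setT (fun t => cos (dotp (rowt t) w + th)).
Proof.
apply: measurableT_comp; first by apply: continuous_measurable_fun; exact: continuous_cos.
by apply: measurable_funD => //; exact: measurable_dotp.
Qed.

(** Exchanges the integral over the mixing variable with the one over space; the majorant is the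
    integrand without its cosine, of total integral [K 0]. It serves twice: for the transform of the
    Matern kernel and, with reciprocal scales, for the inversion formula. *)
Lemma gauss_mixture_fourier n (M sg : R -> R) (L K : 'rV[R]_n -> R) (y w : 'rV[R]_n) (th : R) :
  measurable_fun setT M -> measurable_fun setT (fun x => (4 * sg x)^-1) ->
  (forall x, 0 <= M x) -> (forall x, 0 < sg x) ->
  (forall z, hasint (@lebesgue_measure R) (fun x => M x * expR (- (sqn z / (4 * sg x)))) (L z)) ->
  (forall z, hasint (@lebesgue_measure R)
     (fun x => M x * Num.sqrt (4 * pi * sg x) ^+ n * expR (- (sg x * sqn z))) (K z)) ->
  hasint (leb n) (fun t => L (rowt t - y) * cos (dotp (rowt t) w + th))
    (K w * cos (dotp y w + th)).
Proof.
move=> mM msg M0 sg0 HL HK.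
pose g (x : R) (t : n.-tuple R) := M x * expR (- (sqn (rowt t - y) / (4 * sg x))).
pose f (x : R) (t : n.-tuple R) := g x t * cos (dotp (rowt t) w + th).
have m1 (h : R -> R) : measurable_fun setT h ->
    measurable_fun setT (fun z : measurableTypeR R * n.-tuple R => h z.1).
  by move=> mh; apply: measurableT_comp.
have m2 (h : n.-tuple R -> R) : measurable_fun setT h ->
    measurable_fun setT (fun z : measurableTypeR R * n.-tuple R => h z.2).
  by move=> mh; apply: measurableT_comp.
have mg : measurable_fun setT (fun z : measurableTypeR R * n.-tuple R => g z.1 z.2).
  apply: measurable_funM; first exact: m1.
  apply: measurableT_comp => //; apply: measurableT_comp => //.
  apply: measurable_funM; last exact: (m1 _ msg).
  exact: (m2 _ (measurable_sqn y)).
have mf : measurable_fun setT (fun z : measurableTypeR R * n.-tuple R => f z.1 z.2).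
  by apply: measurable_funM => //; exact: (m2 _ (measurable_cos_phase w th)).
have gg x : hasint (leb n) (g x) (M x * Num.sqrt (4 * pi * sg x) ^+ n).
  have := hasintZ (M x) (hasint_gauss_row y 0 0 (sg0 x)).
  rewrite sqn0 mulr0 oppr0 expR0 mulr1 dotp0r addr0 cos0 mulr1.
  by apply: hasint_ext => t; rewrite dotp0r addr0 cos0 mulr1.
have gG : hasint (@lebesgue_measure R) (fun x => M x * Num.sqrt (4 * pi * sg x) ^+ n) (K 0).
  by apply: hasint_ext (HK 0) => x; rewrite sqn0 mulr0 oppr0 expR0 mulr1.
have fg x t : `|f x t| <= g x t.
  have g0 : 0 <= g x t by rewrite mulr_ge0 ?expR_ge0.
  by rewrite normrM (ger0_norm g0) ler_piMr// normr_cos_le1.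
have fF x := hasintZ (M x) (hasint_gauss_row y w th (sg0 x)).
have fF' x : hasint (leb n) (f x) (M x * (Num.sqrt (4 * pi * sg x) ^+ n *
    expR (- (sg x * sqn w)) * cos (dotp y w + th))).
  by apply: hasint_ext (fF x) => t; rewrite mulrA.
have fL t : hasint (@lebesgue_measure R) (f^~ t) (L (rowt t - y) * cos (dotp (rowt t) w + th)).
  rewrite mulrC; apply: hasint_ext (hasintZ _ (HL (rowt t - y))) => x.
  by rewrite /f mulrC.
have [v [Fv Hv]] := @hasint_swap _ _ _ _ R (@lebesgue_measure R) (leb n) f g
  _ _ _ _ mf mg fg gg gG fF' fL.
suff <- : v = K w * cos (dotp y w + th) by [].
apply: hasint_uniq Fv _; rewrite (mulrC (K w)).
by apply: hasint_ext (hasintZ (cos (dotp y w + th)) (HK w)) => x; ring.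
Qed.

End gauss_tuple.

(** * Gamma and Bessel integrals *)

Section exponential_substitution.
Variable R : realType.
Let mu := @lebesgue_measure R.

Lemma integral_oppr (f : R -> \bar R) : measurable_fun setT f -> (forall x, 0 <= f x)%E ->
  (\int[mu]_x f (- x)%R = \int[mu]_x f x)%E.
Proof.
move=> mf f0.
rewrite -(@eq_measure_integral _ _ _ _ mu (pushforward mu (-%R : _ -> measurableTypeR R))).
  rewrite ge0_integral_pushforward//=.
  - by rewrite preimage_setT; apply: eq_integral => x _; rewrite opprK.
  - exact: measurableT_comp.
by move=> A mA _; exact: lebesgue_measureN.
Qed.

(** Substitution on the compact intervals [A n] and [B n], followed by monotone convergence on both
    sides. *)
Lemma integral_expR_substitution (G : R -> R) : continuous (fun x => G (expR x)) ->
  {in [set x : R | 0 < x], continuous G} -> (forall x, 0 < x -> 0 <= G x) ->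
  (\int[mu]_(x in [set x | (0 < x)%R]) (G x)%:E =
   \int[mu]_x (G (expR x) * expR x)%:E)%E.
Proof.
move=> cGe cG G0.
pose A n : set R := `[expR (- n%:R), expR n%:R]%classic.
pose B n : set R := `[- n%:R, n%:R]%classic.
have AB n : (\int[mu]_(x in A n) (G x)%:E = \int[mu]_(x in B n) (G (expR x) * expR x)%:E)%E.
  have dE : derive1 (@expR R) = expR by apply/funext => x; rewrite derive1E derive_val.
  rewrite (@integration_by_substitution_increasing R expR G).
  - by rewrite dE.
  - by rewrite lerNl (@le_trans _ _ 0)// oppr_le0.
  - by move=> x y _ _; rewrite ltr_expR.
  - by rewrite dE => x _; exact: continuous_expR.
  - rewrite dE; apply/cvg_ex; exists (expR (- n%:R)).
    by apply: cvg_at_right_filter; exact: continuous_expR.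
  - rewrite dE; apply/cvg_ex; exists (expR (n%:R)).
    by apply: cvg_at_left_filter; exact: continuous_expR.
  - split; first by move=> x _; exact: derivable_expR.
      by apply: cvg_at_right_filter; exact: continuous_expR.
    by apply: cvg_at_left_filter; exact: continuous_expR.
  - apply: continuous_in_subspaceT => x; rewrite inE/= in_itv/= => /andP[xn _].
    by apply: cG; rewrite inE/=; apply: lt_le_trans xn; exact: expR_gt0.
have Ap n x : A n x -> 0 < x.
  by rewrite /A/= in_itv/= => /andP[+ _]; apply: lt_le_trans; exact: expR_gt0.
have ndA : nondecreasing_seq A.
  move=> m n mn; rewrite subsetEset => x; rewrite /A/= !in_itv/= => /andP[xm xM].
  by rewrite (le_trans _ xm) ?(le_trans xM)// ler_expR ?lerN2 ler_nat.
have ndB : nondecreasing_seq B.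
  move=> m n mn; rewrite subsetEset => x; rewrite /B/= !in_itv/= => /andP[xm xM].
  by rewrite (le_trans _ xm) ?(le_trans xM)// ?lerN2 ler_nat.
have BT : \bigcup_n B n = setT.
  apply/seteqP; split => // x _; exists (Num.truncn `|x|).+1 => //.
  by rewrite /B/= in_itv/= -ler_norml ltW// truncnS_gt.
have AT : \bigcup_n A n = [set x | 0 < x].
  apply/seteqP; split => [x [n _ /Ap]//|x /= x0].
  have : (\bigcup_n B n) (ln x) by rewrite BT.
  move=> [n _]; rewrite /B/= in_itv/= => /andP[h1 h2]; exists n => //.
  by rewrite /A/= in_itv/= -(lnK x0) !ler_expR h1.
have mP : measurable [set x : R | 0 < x] by rewrite -set_itvoy.
have mG : measurable_fun [set x : R | 0 < x] G.
  by apply: open_continuous_measurable_fun => //; exact: open_gt.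
have H1 : (\int[mu]_(x in A n) (G x)%:E @[n --> \oo] --> \int[mu]_(x in \bigcup_n A n) (G x)%:E)%E.
  apply: (@ge0_nondecreasing_set_cvg_integral _ (measurableTypeR R) R A (EFin \o G) mu ndA).
  - by move=> n; exact: measurable_itv.
  - move=> n; apply/measurable_EFinP; apply: measurable_funS mG => // x; exact: Ap.
  - by move=> n x /Ap x0; rewrite lee_fin G0.
have H2 : (\int[mu]_(x in A n) (G x)%:E @[n --> \oo] -->
    \int[mu]_(x in \bigcup_n B n) (G (expR x) * expR x)%:E)%E.
  under eq_fun do rewrite AB.
  apply: (@ge0_nondecreasing_set_cvg_integral _ (measurableTypeR R) R B
     (fun x => (G (expR x) * expR x)%:E) mu ndB).
  - by move=> n; exact: measurable_itv.
  - move=> n; apply: measurable_funTS; apply/measurable_EFinP/measurable_funM => //.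
    exact: continuous_measurable_fun.
  - by move=> n x _; rewrite lee_fin mulr_ge0 ?expR_ge0 ?G0 ?expR_gt0.
by rewrite -AT -BT; apply: (cvg_unique _ H1 H2); exact: ereal_hausdorff.
Qed.

(** Folding the line at 0. It turns the factor [cosh (a * t)] of [BesselK] into a single exponential
    over the whole line, and later gives the mass of a half line under the normal law. *)
Lemma integral_symmetric (f : R -> R) : measurable_fun setT f -> (forall x, 0 <= f x) ->
  (\int[mu]_(x in [set x | (0 < x)%R]) (f x + f (- x))%:E = \int[mu]_x (f x)%:E)%E.
Proof.
move=> mf f0.
have mNf : measurable_fun setT (fun x : R => f (- x)) by apply: measurableT_comp.
rewrite -set_itvoy; under eq_integral do rewrite EFinD.
rewrite ge0_integralD//; first last.
- exact/measurable_EFinP/measurable_funTS.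
- by move=> x _; rewrite lee_fin.
- exact/measurable_EFinP/measurable_funTS.
- by move=> x _; rewrite lee_fin.
rewrite [in X in (_ + X)%E]integral_itv_obnd_cbnd; last first.
  exact/measurable_EFinP/measurable_funTS.
rewrite (@ge0_integration_by_substitution0 R (fun x => (f (- x))%:E)); last 2 first.
- exact/measurable_EFinP.
- by move=> x; rewrite lee_fin.
under [in X in (_ + X)%E]eq_integral do rewrite opprK.
rewrite -ge0_integral_setU//=.
- by congr integral; rewrite -setCitvl setvU.
- by apply/measurable_EFinP/measurable_funTS.
- by move=> x _; rewrite lee_fin.
- rewrite disj_set2E; apply/eqP; rewrite -subset0 => x [] /=.
  by rewrite !in_itv/= andbT leNgt => ->.
Qed.

Lemma hasint_exp_gamma (b : R) : 0 < b ->
  exists v, hasint mu (fun x => expR (- expR x + b * x)) v.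
Proof.
move=> b0.
have E (r : R) : 0 < r -> hasint mu (exponential_pdf r) 1.
  move=> r0; apply: hasint_ge0P; [exact: measurable_exponential_pdf| |].
    by move=> x; apply: exponential_pdf_ge0; exact: ltW.
  exact: integral_exponential_pdf.
have EN : hasint mu (fun x => exponential_pdf b (- x)) 1.
  have mp := @measurable_exponential_pdf R b.
  apply: hasint_ge0P.
  - exact: measurableT_comp.
  - by move=> x; apply: exponential_pdf_ge0; exact: ltW.
  rewrite (integral_oppr (f := fun x => (exponential_pdf b x)%:E)); first exact: (E b b0).2.
    exact/measurable_EFinP.
  by move=> x; rewrite lee_fin exponential_pdf_ge0 ?ltW.
(* [K] is the exponential of the maximum of [(b + 1) * x - expR x], attained at [ln (b + 1)]. Hence
   the integrand is at most [K * expR (- x)] for [x >= 0]; for [x < 0] it is at most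
   [expR (b * x)]. *)
pose K := expR (- ((b + 1) * (1 - ln (b + 1)))).
have b1 : 0 < b + 1 by rewrite addr_gt0.
apply: dominated_hasint (hasintD (hasintZ K (E 1 ltr01)) (hasintZ b^-1 EN)) _.
  apply: measurableT_comp => //; apply: measurable_funD.
    by apply: measurableT_comp.
  by apply: measurable_funM.
move=> x; rewrite ger0_norm ?expR_ge0//.
have [x0|x0] := leP 0 x.
  apply: (@le_trans _ _ (K * exponential_pdf 1 x)); last first.
    by rewrite lerDl mulr_ge0 ?invr_ge0 ?(ltW b0)// exponential_pdf_ge0 ?ltW.
  rewrite exponential_pdfE// mul1r -expRD ler_expR.
  have : (b + 1) * (1 + (x - ln (b + 1))) <= expR x.
    rewrite -(ler_pdivlMl _ _ b1) (le_trans (expR_ge1Dx _))//.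
    by rewrite expRD expRN lnK ?posrE// mulrC.
  lra.
apply: (@le_trans _ _ (b^-1 * exponential_pdf b (- x))); last first.
  by rewrite lerDr mulr_ge0 ?expR_ge0// exponential_pdf_ge0.
rewrite exponential_pdfE ?oppr_ge0 ?(ltW x0)// mulKf ?gt_eqF// ler_expR.
by rewrite mulrNN gerDr oppr_le0 expR_ge0.
Qed.

End exponential_substitution.

(** * Positivity, bounds and continuity of exponential mixtures *)

Section laplace_mixture.
Variable R : realType.
Let mu := @lebesgue_measure R.

(** A nonnegative function of integral 0 vanishes almost everywhere, but an interval of positive
    length is not negligible. Asking for positivity on one interval only is what the definiteness
    proof needs. *)
Lemma hasint_itv_gt0 (f : R -> R) v (p q : R) : hasint mu f v -> (forall x, 0 <= f x) ->
  p < q -> (forall x, p <= x <= q -> 0 < f x) -> 0 < v.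
Proof.
move=> fv f0 pq fpq; rewrite lt_neqAle (hasint_ge0 fv) ?andbT//.
apply/eqP => v0.
have := (@ae_eq_integral_abs _ _ R mu setT measurableT (EFin \o f) (measurable_int _ fv.1)).1.
rewrite (_ : (\int[mu]_x `|(EFin \o f) x|)%E = 0); last first.
  rewrite -[RHS]/(0%:E) v0 -fv.2; apply: eq_integral => x _ /=.
  by rewrite ger0_norm.
move=> /(_ erefl) [N [mN N0 fN]].
have NT : `[p, q]%classic `<=` N.
  move=> x; rewrite /= in_itv/= => /fpq fx; apply: fN => /= /(_ Logic.I) [] fx0.
  by rewrite fx0 ltxx in fx.
have : (mu `[p, q]%classic <= mu N)%E.
  by apply: le_measure; rewrite ?inE//; exact: measurable_itv.
have -> : mu N = 0%E by exact: N0.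
by rewrite /mu lebesgue_measure_itv/= lte_fin pq -EFinB lee_fin subr_le0 leNgt pq.
Qed.

Lemma hasint_pos (f : R -> R) v : hasint mu f v -> (forall x, 0 < f x) -> 0 < v.
Proof. by move=> fv f0; apply: (hasint_itv_gt0 fv _ (@ltr01 R)) => [x|x _]; [exact/ltW|]. Qed.

Variables (M b : R -> R) (v : R).
Hypotheses (mM : measurable_fun setT M) (mb : measurable_fun setT b).
Hypotheses (M0 : forall x, 0 < M x) (b0 : forall x, 0 < b x) (Mv : hasint mu M v).

(** The absolute value keeps the integrand below [M x] for every real [l], so that continuity holds
    on the whole line and 0 is not a boundary point. *)
Definition laplace_mix (l : R) : R := fine (\int[mu]_x (M x * expR (- (`|l| * b x)))%:E)%E.

Lemma hasint_laplace_mix (l : R) : 0 <= l ->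
  hasint mu (fun x => M x * expR (- (l * b x))) (laplace_mix l).
Proof.
move=> l0; have [u [ui _]] : exists u, hasint mu (fun x => M x * expR (- (l * b x))) u.
  apply: dominated_hasint Mv _.
    apply: measurable_funM => //; apply: measurableT_comp => //.
    by apply: measurableT_comp => //; apply: measurable_funM.
  move=> x; rewrite normrM !gtr0_norm ?expR_gt0// ler_piMr ?(ltW (M0 x))//.
  by rewrite -expR0 ler_expR oppr_le0 mulr_ge0 ?(ltW (b0 x)).
by have := hasintP ui; rewrite /laplace_mix ger0_norm.
Qed.

Lemma laplace_mix_gt0 (l : R) : 0 <= l -> 0 < laplace_mix l.
Proof.
by move=> /hasint_laplace_mix/hasint_pos; apply=> x; rewrite mulr_gt0 ?expR_gt0.
Qed.

Lemma laplace_mix_le (l : R) : 0 <= l -> laplace_mix l <= v.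
Proof.
move=> l0; apply: (hasint_le (hasint_laplace_mix l0) Mv) => x.
rewrite ler_piMr ?(ltW (M0 x))// -expR0 ler_expR oppr_le0 mulr_ge0//.
exact: ltW.
Qed.

Lemma continuous_laplace_mix : continuous laplace_mix.
Proof.
move=> l.
have := @continuity_under_integral R _ _ mu (fun l x => M x * expR (- (`|l| * b x)))
  setT measurableT (l - 1) (l + 1) _ _ M Mv.1 _ l; apply.
- move=> x _; have [+ _] := hasint_laplace_mix (normr_ge0 x); exact.
- apply/aeW => x _ y _; apply: cvgM; first exact: cvg_cst.
  apply: continuous_cvg; first exact: continuous_expR.
  apply: cvgN; apply: cvgM; last exact: cvg_cst.
  exact: norm_continuous.
- move=> x _; apply/aeW => y _.
  rewrite normrM (gtr0_norm (M0 y)) (gtr0_norm (expR_gt0 _)) ler_piMr ?(ltW (M0 y))//.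
  by rewrite -expR0 ler_expR oppr_le0 mulr_ge0 ?(ltW (b0 y)).
- by rewrite inE/= in_itv/= ltrBlDr ltrDl ltr01.
Qed.

End laplace_mixture.

Lemma cvg_sum_fin (R : realType) (T : Type) (F : set_system T) {FF : Filter F} (I : finType)
    (f : I -> T -> R) (l : I -> R) :
  (forall i, f i x @[x --> F] --> l i) -> \sum_i f i x @[x --> F] --> \sum_i l i.
Proof.
move=> fl; rewrite -big_enum/= (_ : (fun x => _) = (fun x => \sum_(i <- enum I) f i x)).
  elim: (enum I) => [|i s IH].
    by rewrite big_nil; under eq_fun do rewrite big_nil; exact: cvg_cst.
  by rewrite big_cons; under eq_fun do rewrite big_cons; apply: cvgD.
by apply/funext => x; rewrite big_enum.
Qed.

(** * Integrals over row vectors as integrals over tuples *)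

Section row_integrals.
Variables (R : realType) (n : nat).
Local Notation leb := (@tuple_lebesgue R n).

Lemma continuous_sqn : continuous (@sqn R n).
Proof.
move=> x; apply: (@cvg_sum_fin _ _ (nbhs x)) => i.
by apply: cvgM; exact: coord_continuous.
Qed.

Lemma Rint_integral (f : 'rV[R]_n -> R) : Rd_measurable f ->
  Defs.Rint f = (\int[leb]_t (f (rowt t))%:E)%E.
Proof.
move=> mf.
have mf' : measurable_fun setT (fun t : n.-tuple R => f (rowt t)) by [].
rewrite /Defs.Rint !iint_tuple; first last.
- by move=> x; rewrite lee_fin le_max lexx orbT.
- by apply/measurable_EFinP; apply: measurable_maxr.
- by move=> x; rewrite lee_fin le_max lexx orbT.
- by apply/measurable_EFinP; apply: measurable_maxr => //; apply: measurableT_comp.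
rewrite [RHS]integralE; congr (_ - _)%E; apply: eq_integral => t _.
  by rewrite funeposE EFin_max.
by rewrite funenegE EFin_max.
Qed.

Lemma Rint_hasint (f : 'rV[R]_n -> R) v : hasint leb (fun t => f (rowt t)) v ->
  Defs.Rint f = v%:E.
Proof. by move=> fv; rewrite Rint_integral ?fv.2//; exact: hasint_measurable fv. Qed.

Lemma iint_hasint (f : 'rV[R]_n -> R) v : hasint leb (fun t => f (rowt t)) v ->
  (forall x, 0 <= f x) -> iint (fun x => (f x)%:E) = v%:E.
Proof.
move=> fv f0; rewrite iint_tuple ?fv.2//.
by apply/measurable_EFinP; exact: hasint_measurable fv.
Qed.

Lemma hasint_iint (f : 'rV[R]_n -> R) : Rd_measurable f ->
  (forall x, 0 <= f x) -> (iint (fun x => (f x)%:E) < +oo)%E ->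
  hasint leb (fun t => f (rowt t)) (fine (iint (fun x => (f x)%:E))).
Proof.
move=> mf f0; have mf' : measurable_fun setT (fun t : n.-tuple R => f (rowt t)) by [].
have -> : iint (fun x => (f x)%:E) = (\int[leb]_t (f (rowt t))%:E)%E.
  by rewrite iint_tuple//; apply/measurable_EFinP.
move=> foo; apply: hasint_ge0P => //; rewrite fineK// ge0_fin_numE//.
by apply: integral_ge0 => t _; rewrite lee_fin.
Qed.

End row_integrals.

Section gamma_bessel.
Variable R : realType.
Let mu := @lebesgue_measure R.

Lemma hasint_Gamma (b : R) : 0 < b ->
  hasint mu (fun x => expR (- expR x + b * x)) (Gamma b).
Proof.
move=> b0; have [v bv] := hasint_exp_gamma b0.
suff -> : Gamma b = v by [].
rewrite /Gamma; pose G (t : R) := expR ((b - 1) * ln t) * expR (- t).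
transitivity (fine (\int[mu]_(t in [set t : R | (0 < t)%R]) (G t)%:E)%E).
  congr fine; apply: eq_integral => t; rewrite inE/= => t0.
  by rewrite /G /powR gt_eqF.
rewrite integral_expR_substitution.
- rewrite -[RHS]/(fine v%:E) -bv.2; congr fine; apply: eq_integral => x _.
  by rewrite /G expRK -!expRD; congr (expR _)%:E; ring.
- move=> x; rewrite /G; apply: cvgM; apply: continuous_cvg; try exact: continuous_expR.
    rewrite expRK; apply: cvgM; first exact: cvg_cst.
    by under eq_fun do rewrite expRK; exact: cvg_id.
  by apply: cvgN; exact: continuous_expR.
- move=> x; rewrite inE/= => x0; rewrite /G; apply: cvgM; apply: continuous_cvg;
    try exact: continuous_expR.
    by apply: cvgM; [exact: cvg_cst | exact: continuous_ln].
  by apply: cvgN; exact: cvg_id.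
- by move=> x _; rewrite mulr_ge0 ?expR_ge0.
Qed.

Lemma Gamma_gt0 (b : R) : 0 < b -> 0 < Gamma b.
Proof. by move=> /hasint_Gamma/hasint_pos; apply=> x; exact: expR_gt0. Qed.

Lemma hasint_BesselK (a r : R) : 0 < a -> 0 < r ->
  hasint mu (fun x => expR (- expR x + a * x) * expR (- (r ^+ 2 / (4 * expR x))))
    (2 * powR (r / 2) a * BesselK a r).
Proof.
move=> a0 r0; have r20 : 0 < r / 2 by rewrite divr_gt0.
pose h x := expR (- expR x + a * x) * expR (- (r ^+ 2 / (4 * expR x))).
have dh x : continuous_at x h.
  rewrite /continuous_at /h; apply: cvgM; apply: continuous_cvg; try exact: continuous_expR.
    apply: cvgD; first by apply: cvgN; exact: continuous_expR.
    by apply: cvgM; [exact: cvg_cst | exact: cvg_id].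
  apply: cvgN; apply: cvgM; first exact: cvg_cst.
  apply: cvgV; first by rewrite mulf_neq0// gt_eqF ?expR_gt0.
  by apply: cvgM; [exact: cvg_cst | exact: continuous_expR].
have [v hv] : exists v, hasint mu h v.
  have [u au] := hasint_exp_gamma a0; apply: dominated_hasint au _.
    exact: continuous_measurable_fun.
  move=> x; rewrite /h normrM !ger0_norm ?expR_ge0// ler_piMr ?expR_ge0//.
  by rewrite -expR0 ler_expR oppr_le0 divr_ge0 ?sqr_ge0// mulr_ge0 ?expR_ge0.
suff -> : 2 * powR (r / 2) a * BesselK a r = v by [].
(* Under [x = t + ln (r / 2)], the terms [expR x] and [r^2 / (4 * expR x)] become [r / 2] times
   [expR t] and [expR (- t)], and they add up to [r * cosh t]. Folding the line then restores
   [cosh (a * t)]. *)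
pose f t := expR (- (r * cosh t)) * expR (a * t) / 2.
have fE t : powR (r / 2) a * 2 * f t = h ((t - - ln (r / 2)) * 1).
  rewrite /f /h /cosh /powR (gt_eqF r20) mulr1 opprK.
  have h2 (x y : R) : x * 2 * (y / 2) = x * y by field.
  rewrite h2 -!expRD; congr expR; rewrite expRD lnK ?posrE// expRN.
  set e := expR t; have e0 : e != 0 by rewrite gt_eqF ?expR_gt0.
  by field; rewrite e0 gt_eqF.
have p0 : 0 < powR (r / 2) a by rewrite powR_gt0.
have fv : hasint mu f (v / (powR (r / 2) a * 2)).
  have := hasint_affine (- ln (r / 2)) dh ltr01 hv; rewrite invr1 mul1r => H.
  rewrite mulrC; apply: hasint_ext (hasintZ (powR (r / 2) a * 2)^-1 H) => t.
  by rewrite -fE mulKf// mulf_neq0// gt_eqF.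
have KE : BesselK a r = v / (powR (r / 2) a * 2).
  rewrite -[RHS]/(fine _%:E) -fv.2 /BesselK; congr fine.
  rewrite -(integral_symmetric (hasint_measurable fv)); last first.
    by move=> x; rewrite /f divr_ge0// mulr_ge0 ?expR_ge0.
  apply: eq_integral => x _; congr EFin; rewrite /f /cosh opprK mulrN (addrC (expR (- x))).
  by field.
by rewrite KE; field; rewrite gt_eqF.
Qed.

End gamma_bessel.

(** * The Matern kernel and its Fourier transform *)

Section matern.
Variables (R : realType) (d : nat) (nu : R).
Hypothesis nud : d%:R / 2 < nu.
Let mu := @lebesgue_measure R.
Local Notation leb := (@tuple_lebesgue R d).
Local Notation a := (nu - d%:R / 2).

Let a0 : 0 < a. Proof. by rewrite subr_gt0. Qed.

(** Density of the logarithm of a variable of law Gamma([nu - d/2]). *)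
Definition gamma_weight (x : R) := (Gamma a)^-1 * expR (- expR x + a * x).

Lemma measurable_exp_gamma (b : R) : measurable_fun setT (fun x : R => expR (- expR x + b * x)).
Proof.
apply: measurableT_comp => //; apply: measurable_funD; last exact: measurable_funM.
exact: measurableT_comp.
Qed.

Lemma measurable_gamma_weight : measurable_fun setT gamma_weight.
Proof. by apply: measurable_funM => //; exact: measurable_exp_gamma. Qed.

Lemma gamma_weight_gt0 x : 0 < gamma_weight x.
Proof. by rewrite mulr_gt0 ?invr_gt0 ?Gamma_gt0 ?expR_gt0. Qed.

Lemma hasint_gamma_weight : hasint mu gamma_weight 1.
Proof.
have := hasintZ (Gamma a)^-1 (hasint_Gamma a0).
by rewrite mulVf// gt_eqF ?Gamma_gt0.
Qed.

Lemma enorm_sqr (z : 'rV[R]_d) : enorm z ^+ 2 = sqn z.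
Proof. by rewrite sqr_sqrtr// sqn_ge0. Qed.

Lemma Matern0 : Matern nu (0 : 'rV[R]_d) = 1.
Proof. by rewrite /Matern eqxx. Qed.

(** Away from 0 this is the Bessel integral. At 0 the Gaussian factor is 1, and the value 1 set by
    convention is the total mass of [gamma_weight]. *)
Lemma hasint_Matern (z : 'rV[R]_d) :
  hasint mu (fun x => gamma_weight x * expR (- (sqn z / (4 * expR x)))) (Matern nu z).
Proof.
have [->|z0] := eqVneq z 0.
  rewrite Matern0; apply: hasint_ext hasint_gamma_weight => x.
  by rewrite sqn0 mul0r oppr0 expR0 mulr1.
have r0 : 0 < enorm z by rewrite sqrtr_gt0 lt_neqAle sqn_ge0 eq_sym sqn_eq0 z0.
have := hasintZ (Gamma a)^-1 (hasint_BesselK a0 r0).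
rewrite enorm_sqr (_ : (Gamma a)^-1 * _ = Matern nu z).
  by apply: hasint_ext => x; rewrite mulrA.
rewrite /Matern (negbTE z0) powRM ?(ltW r0)// ?invr_ge0//.
have p0 : powR 2 a != 0 :> R by rewrite gt_eqF ?powR_gt0.
have -> : powR 2^-1 a = (powR 2 a)^-1 :> R.
  by apply: (mulIf p0); rewrite mulVf// -powRM// mulVf// powR1.
rewrite (@powRD _ 2 a (-1)) ?pnatr_eq0 ?implybT// (@powRN _ 2 1) powRr1//.
by field; rewrite p0 gt_eqF ?Gamma_gt0.
Qed.

Definition fourier_weight (x : R) := gamma_weight x * Num.sqrt (4 * pi * expR x) ^+ d.

Lemma sqrt_expR_exprn (c x : R) : 0 <= c ->
  Num.sqrt (c * expR x) ^+ d = Num.sqrt c ^+ d * expR (d%:R / 2 * x).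
Proof.
move=> c0; rewrite sqrtrM// exprMn; congr (_ * _).
rewrite -mulrA expRM_natl; congr (_ ^+ _).
have -> : expR x = expR (2^-1 * x) ^+ 2 by rewrite -expRM_natl; congr expR; field.
by rewrite sqrtr_sqr ger0_norm ?expR_ge0.
Qed.

(** The Gaussian of scale [expR x] has a mass proportional to [expR (d / 2 * x)], which raises the
    exponent from [nu - d/2] to [nu]: the new weight is again of Gamma type, hence integrable. *)
Lemma fourier_weightE x : fourier_weight x =
  (Gamma a)^-1 * Num.sqrt (4 * pi) ^+ d * expR (- expR x + nu * x).
Proof.
rewrite /fourier_weight sqrt_expR_exprn ?mulr_ge0 ?pi_ge0//.
have -> : - expR x + nu * x = (- expR x + a * x) + d%:R / 2 * x by ring.
by rewrite expRD /gamma_weight; ring.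
Qed.

Lemma measurable_fourier_weight : measurable_fun setT fourier_weight.
Proof.
rewrite (funext fourier_weightE).
by apply: measurable_funM => //; exact: measurable_exp_gamma.
Qed.

Lemma fourier_weight_gt0 x : 0 < fourier_weight x.
Proof.
by rewrite mulr_gt0 ?gamma_weight_gt0// exprn_gt0// sqrtr_gt0 !mulr_gt0 ?pi_gt0 ?expR_gt0.
Qed.

Lemma hasint_fourier_weight : exists v, hasint mu fourier_weight v.
Proof.
have nu0 : 0 < nu by apply: le_lt_trans nud; rewrite divr_ge0.
have := hasintZ ((Gamma a)^-1 * Num.sqrt (4 * pi) ^+ d) (hasint_Gamma nu0) => H.
by eexists; apply: hasint_ext H => x; rewrite fourier_weightE.
Qed.

(* [khat] is the unnormalised Fourier transform [\int Psi x * cos (x.w) dx]. *)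
Definition khat (w : 'rV[R]_d) := laplace_mix fourier_weight expR (sqn w).

Lemma hasint_khat w :
  hasint mu (fun x => fourier_weight x * expR (- (expR x * sqn w))) (khat w).
Proof.
have [v Hv] := hasint_fourier_weight.
have := hasint_laplace_mix measurable_fourier_weight (@measurable_expR R) fourier_weight_gt0
  (@expR_gt0 R) Hv (sqn_ge0 w).
by apply: hasint_ext => x; rewrite (mulrC (sqn w)).
Qed.

Lemma khat_gt0 w : 0 < khat w.
Proof.
have [v Hv] := hasint_fourier_weight.
exact: (laplace_mix_gt0 measurable_fourier_weight (@measurable_expR R) fourier_weight_gt0
  (@expR_gt0 R) Hv (sqn_ge0 w)).
Qed.

Lemma khat_le : exists B, forall w, khat w <= B.
Proof.
have [v Hv] := hasint_fourier_weight; exists v => w.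
exact: (laplace_mix_le measurable_fourier_weight (@measurable_expR R) fourier_weight_gt0
  (@expR_gt0 R) Hv (sqn_ge0 w)).
Qed.

Lemma measurable_khat : measurable_fun setT (fun t => khat (rowt t)).
Proof.
have [v Hv] := hasint_fourier_weight.
have ck := continuous_laplace_mix measurable_fourier_weight (@measurable_expR R)
  fourier_weight_gt0 (@expR_gt0 R) Hv.
have ms : measurable_fun setT (fun t : d.-tuple R => sqn (rowt t)).
  by have := measurable_sqn (0 : 'rV[R]_d); under eq_fun do rewrite subr0.
exact: (measurableT_comp (continuous_measurable_fun ck) ms).
Qed.

(** The scale dual to [expR x]: as a function of [w], [expR (- (s * sqn w))] is the Gaussian of
    scale [(4 * s)^-1]. *)
Let inv4exp (x : R) := (4 * expR x)^-1.

Let inv4expE x : inv4exp x = 4^-1 * expR (- x).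
Proof. by rewrite /inv4exp invfM expRN. Qed.

Let minv4exp : measurable_fun setT inv4exp.
Proof.
rewrite (funext inv4expE).
by apply: measurable_funM => //; apply: measurableT_comp.
Qed.

Let inv4exp_gt0 x : 0 < inv4exp x.
Proof. by rewrite inv4expE mulr_gt0 ?invr_gt0 ?expR_gt0. Qed.

Lemma MaternE (z : 'rV[R]_d) : Matern nu z = laplace_mix gamma_weight inv4exp (sqn z).
Proof.
have := hasint_laplace_mix measurable_gamma_weight minv4exp gamma_weight_gt0 inv4exp_gt0
  hasint_gamma_weight (sqn_ge0 z).
exact/hasint_uniq/hasint_Matern.
Qed.

Lemma Matern_ge0 (z : 'rV[R]_d) : 0 <= Matern nu z.
Proof.
apply: (hasint_ge0 (hasint_Matern z)) => x.
by rewrite mulr_ge0 ?expR_ge0// ltW ?gamma_weight_gt0.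
Qed.

Lemma Matern_le1 (z : 'rV[R]_d) : Matern nu z <= 1.
Proof.
rewrite MaternE; exact: (laplace_mix_le measurable_gamma_weight minv4exp gamma_weight_gt0
  inv4exp_gt0 hasint_gamma_weight (sqn_ge0 z)).
Qed.

Lemma MaternN (z : 'rV[R]_d) : Matern nu (- z) = Matern nu z.
Proof. by rewrite !MaternE sqnN. Qed.

Let cmix := continuous_laplace_mix measurable_gamma_weight minv4exp gamma_weight_gt0
  inv4exp_gt0 hasint_gamma_weight.

Lemma continuous_Matern : continuous (@Matern R d nu).
Proof.
move=> z; rewrite (_ : @Matern R d nu = laplace_mix gamma_weight inv4exp \o @sqn R d).
  by apply: continuous_comp; [exact: continuous_sqn | exact: cmix].
by apply/funext => x; exact: MaternE.
Qed.

Lemma measurable_Matern (y : 'rV[R]_d) : measurable_fun setT (fun t => Matern nu (rowt t - y)).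
Proof.
under eq_fun do rewrite MaternE.
exact: (measurableT_comp (continuous_measurable_fun cmix) (measurable_sqn y)).
Qed.

Lemma Matern_fourier (y w : 'rV[R]_d) th :
  hasint leb (fun t => Matern nu (rowt t - y) * cos (dotp (rowt t) w + th))
    (khat w * cos (dotp y w + th)).
Proof.
apply: (@gauss_mixture_fourier _ _ gamma_weight expR).
- exact: measurable_gamma_weight.
- exact: minv4exp.
- by move=> x; exact/ltW/gamma_weight_gt0.
- exact: expR_gt0.
- exact: hasint_Matern.
- exact: hasint_khat.
Qed.

(** [khat] is itself a mixture of Gaussians, of scales [inv4exp], so the computation of the
    transform applies a second time and returns to the kernel. *)
Lemma khat_fourier (x : 'rV[R]_d) th :
  hasint leb (fun t => khat (rowt t) * cos (dotp (rowt t) x + th))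
    ((2 * pi) ^+ d * Matern nu x * cos th).
Proof.
have -> : cos th = cos (dotp 0 x + th) by rewrite dotp0l add0r.
apply: (@hasint_ext _ _ _ _ _ (fun t => khat (rowt t - 0) * cos (dotp (rowt t) x + th))).
  by move=> t; rewrite subr0.
have sE y : 4 * inv4exp y = expR (- y) by rewrite inv4expE mulVKf.
apply: (@gauss_mixture_fourier _ _ fourier_weight inv4exp _ (fun z => (2 * pi) ^+ d * Matern nu z)).
- exact: measurable_fourier_weight.
- by under eq_fun do rewrite sE expRN invrK; exact: measurable_expR.
- by move=> y; exact/ltW/fourier_weight_gt0.
- exact: inv4exp_gt0.
- move=> z; apply: hasint_ext (hasint_khat z) => y.
  by rewrite sE (expRN y) invrK (mulrC (sqn z)).
- move=> z; apply: hasint_ext (hasintZ ((2 * pi) ^+ d) (hasint_Matern z)) => y.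
  (* A Gaussian of scale [s] and its dual have masses [sqrt (4 pi s)^d] and [sqrt (pi / s)^d], whose
     product does not depend on [s]. *)
  have -> : (2 * pi) ^+ d =
      Num.sqrt (4 * pi * expR y) ^+ d * Num.sqrt (4 * pi * inv4exp y) ^+ d.
    rewrite -exprMn -sqrtrM ?mulr_ge0 ?pi_ge0 ?expR_ge0//; congr (_ ^+ _).
    rewrite [4 * pi * inv4exp y]mulrAC sE.
    rewrite (_ : 4 * pi * expR y * (expR (- y) * pi) = (2 * pi) ^+ 2).
      by rewrite sqrtr_sqr ger0_norm// mulr_ge0// pi_ge0.
    by rewrite expRN; field; rewrite gt_eqF ?expR_gt0.
  by rewrite /fourier_weight (mulrC (inv4exp y)) -/(inv4exp y); ring.
Qed.

Lemma FT_re_Matern w : FT_re (@Matern R d nu) w = powR (pi *+ 2) (- (d%:R / 2)) * khat w.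
Proof.
rewrite /FT_re; congr (_ * _).
rewrite (@Rint_hasint _ _ _ (khat w))//.
have := Matern_fourier 0 w 0; rewrite dotp0l addr0 cos0 mulr1.
by apply: hasint_ext => t; rewrite subr0 addr0.
Qed.

End matern.

(** * Positive definiteness *)

Section quadratic_form.
Variables (R : realType) (d : nat) (nu : R).
Hypothesis nud : d%:R / 2 < nu.
Let mu := @lebesgue_measure R.
Local Notation leb := (@tuple_lebesgue R d).
Local Notation Psi := (@Matern R d nu).
Variables (I : finType) (u : I -> R) (y : I -> 'rV[R]_d).

Definition qform := \sum_i \sum_j u i * u j * Psi (y i - y j).

(** Real part of the exponential sum of frequencies [y i]; [trigs] is its imaginary part. *)
Definition trigc (w : 'rV[R]_d) := \sum_i u i * cos (dotp w (y i)).
Definition trigs (w : 'rV[R]_d) := \sum_i u i * sin (dotp w (y i)).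

Lemma dotpBr (w x z : 'rV[R]_d) : dotp w (x - z) = dotp w x - dotp w z.
Proof. by rewrite dotpC dotpBl ![dotp _ w]dotpC. Qed.

Lemma trig_sqr w :
  trigc w ^+ 2 + trigs w ^+ 2 = \sum_i \sum_j u i * u j * cos (dotp w (y i - y j)).
Proof.
rewrite /trigc /trigs !expr2 !mulr_suml -big_split/=; apply: eq_bigr => i _.
rewrite !mulr_sumr -big_split/=; apply: eq_bigr => j _.
by rewrite dotpBr cosB; ring.
Qed.

Lemma trig_sqr_ge0 w : 0 <= trigc w ^+ 2 + trigs w ^+ 2.
Proof. by rewrite addr_ge0 ?sqr_ge0. Qed.

Lemma hasint_trig_sqr (h : 'rV[R]_d -> R) (H : 'rV[R]_d -> R) :
  (forall x, hasint leb (fun t => h (rowt t) * cos (dotp (rowt t) x)) (H x)) ->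
  hasint leb (fun t => h (rowt t) * (trigc (rowt t) ^+ 2 + trigs (rowt t) ^+ 2))
    (\sum_i \sum_j u i * u j * H (y i - y j)).
Proof.
move=> hH.
have : hasint leb (fun t => \sum_i \sum_j u i * u j *
    (h (rowt t) * cos (dotp (rowt t) (y i - y j)))) (\sum_i \sum_j u i * u j * H (y i - y j)).
  by apply: hasint_sum => i; apply: hasint_sum => j; exact: hasintZ.
apply: hasint_ext => t; rewrite trig_sqr mulr_sumr; apply: eq_bigr => i _.
by rewrite mulr_sumr; apply: eq_bigr => j _; rewrite mulrCA.
Qed.

Lemma hasint_qform :
  hasint leb (fun t => khat nu (rowt t) * (trigc (rowt t) ^+ 2 + trigs (rowt t) ^+ 2))
    ((2 * pi) ^+ d * qform).
Proof.
have H x : hasint leb (fun t => khat nu (rowt t) * cos (dotp (rowt t) x))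
    ((2 * pi) ^+ d * Psi x).
  have := khat_fourier nud x 0; rewrite cos0 mulr1.
  by apply: hasint_ext => t; rewrite addr0.
have := hasint_trig_sqr H; congr (hasint _ _ _).
rewrite /qform mulr_sumr; apply: eq_bigr => i _; rewrite mulr_sumr.
by apply: eq_bigr => j _; ring.
Qed.

Lemma qform_ge0 : 0 <= qform.
Proof.
have p0 : 0 < (2 * pi : R) ^+ d by rewrite exprn_gt0// mulr_gt0// pi_gt0.
rewrite -(pmulr_rge0 _ p0); apply: (hasint_ge0 hasint_qform) => t.
by rewrite mulr_ge0 ?trig_sqr_ge0// ltW ?khat_gt0.
Qed.

Definition gauss_form (s : R) := \sum_i \sum_j u i * u j * expR (- (sqn (y i - y j) / (4 * s))).

(** Same spectral argument as for [qform]: up to a positive factor, the Gaussian of scale [s] is the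
    transform of the one of scale [s']. *)
Lemma gauss_form_ge0 (s : R) : 0 < s -> 0 <= gauss_form s.
Proof.
move=> s0; pose s' := (4 * s)^-1.
have s'0 : 0 < s' by rewrite invr_gt0 mulr_gt0.
have H x : hasint leb (fun t => expR (- (sqn (rowt t) / (4 * s'))) * cos (dotp (rowt t) x))
    (Num.sqrt (4 * pi * s') ^+ d * expR (- (s' * sqn x))).
  have := hasint_gauss_row 0 x 0 s'0; rewrite dotp0l addr0 cos0 mulr1.
  by apply: hasint_ext => t; rewrite addr0 subr0.
have p0 : 0 < Num.sqrt (4 * pi * s') ^+ d by rewrite exprn_gt0// sqrtr_gt0 !mulr_gt0// pi_gt0.
have := hasint_ge0 (hasint_trig_sqr (h := fun w => expR (- (sqn w / (4 * s')))) H) _.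
rewrite (_ : \sum_i _ = Num.sqrt (4 * pi * s') ^+ d * gauss_form s).
  rewrite (pmulr_rge0 _ p0); apply=> t.
  by rewrite mulr_ge0 ?expR_ge0 ?trig_sqr_ge0.
rewrite /gauss_form mulr_sumr; apply: eq_bigr => i _; rewrite mulr_sumr.
by apply: eq_bigr => j _; rewrite [s' * _]mulrC; ring.
Qed.

Lemma hasint_gauss_form :
  hasint mu (fun x => gamma_weight d nu x * gauss_form (expR x)) qform.
Proof.
have := hasint_sum (fun i => hasint_sum (fun j =>
  hasintZ (u i * u j) (hasint_Matern nud (y i - y j)))).
apply: hasint_ext => x; rewrite mulr_sumr; apply: eq_bigr => i _.
by rewrite mulr_sumr; apply: eq_bigr => j _; rewrite mulrCA.
Qed.

(* For small [s] the Gaussian Gram matrix is close to the identity. *)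
Lemma gauss_form_lower (s : R) : injective y -> 0 < s ->
  \sum_i u i ^+ 2 - s * (\sum_i \sum_j `|u i * u j| * (4 / sqn (y i - y j))) <= gauss_form s.
Proof.
move=> yI s0; rewrite mulr_sumr -sumrB; apply: ler_sum => i _.
(* On the diagonal [4 / sqn 0] is 0 because the inverse of 0 is 0, so the error sum has no diagonal
   terms. *)
rewrite mulr_sumr (bigD1 i)//= [in leRHS](bigD1 i)//= subrr sqn0 invr0 !mulr0 add0r.
rewrite mul0r oppr0 expR0 mulr1 -expr2 lerD2l -sumrN; apply: ler_sum => j ji.
have q0 : 0 < sqn (y i - y j).
  rewrite lt_neqAle sqn_ge0 andbT eq_sym sqn_eq0 subr_eq0.
  by apply: contra ji => /eqP/yI ->.
rewrite lerNl -mulrN.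
apply: (@le_trans _ _ (`|u i * u j| * expR (- (sqn (y i - y j) / (4 * s))))).
  by rewrite mulrN -mulNr ler_wpM2r ?expR_ge0// -normrN ler_norm.
(* The off-diagonal bound is [expR (- t) <= t^-1] at [t = sqn (y i - y j) / (4 * s)], a consequence
   of [1 + t <= expR t]. *)
rewrite mulrCA ler_wpM2l// expRN.
rewrite -[leRHS]invrK lef_pV2 ?posrE ?expR_gt0 ?invr_gt0 ?mulr_gt0 ?invr_gt0//.
rewrite (_ : (_ * _)^-1 = sqn (y i - y j) / (4 * s)).
  by apply: le_trans (expR_ge1Dx _); rewrite lerDr.
by field; rewrite !gt_eqF.
Qed.

Lemma qform_gt0 : injective y -> (exists i, u i != 0) -> 0 < qform.
Proof.
move=> yI [i ui].
pose S := \sum_i u i ^+ 2; pose B := \sum_i \sum_j `|u i * u j| * (4 / sqn (y i - y j)).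
have S0 : 0 < S.
  rewrite /S (bigD1 i)//= ltr_pwDl ?exprn_even_gt0//.
  by apply: sumr_ge0 => j _; exact: sqr_ge0.
have B0 : 0 <= B.
  apply: sumr_ge0 => j _; apply: sumr_ge0 => k _.
  by rewrite mulr_ge0// divr_ge0 ?sqn_ge0.
have B1 : 0 < B + 1 by rewrite ltr_wpDl.
(* For [x <= q] the lower bound [S - expR x * B] is positive; [B + 1] avoids dividing by 0. Any
   interval ending at [q] would do. *)
pose q := ln (S / (B + 1)).
have w0 x := gamma_weight_gt0 nud x.
apply: (@hasint_itv_gt0 _ _ _ (q - 1) q hasint_gauss_form) => [x||x /andP[_ xq]].
- by rewrite mulr_ge0 ?gauss_form_ge0 ?expR_gt0// ltW.
- by rewrite ltrBlDr ltrDl.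
rewrite mulr_gt0//; apply: lt_le_trans (gauss_form_lower yI (expR_gt0 _)).
rewrite subr_gt0 -/S -/B; apply: (@le_lt_trans _ _ (S / (B + 1) * B)).
  rewrite ler_wpM2r//; apply: le_trans (_ : expR q <= _); first by rewrite ler_expR.
  by rewrite lnK// posrE divr_gt0.
by rewrite mulrAC ltr_pdivrMr// ltr_pM2l// ltrDl.
Qed.

Lemma trigc_norm_le w : `|trigc w| <= \sum_i `|u i|.
Proof.
apply: le_trans (ler_norm_sum _ _ _) _; apply: ler_sum => i _.
by rewrite normrM ler_piMr ?normr_cos_le1.
Qed.

Lemma trigs_norm_le w : `|trigs w| <= \sum_i `|u i|.
Proof.
apply: le_trans (ler_norm_sum _ _ _) _; apply: ler_sum => i _.
by rewrite normrM ler_piMr ?normr_sin_le1.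
Qed.

Lemma measurable_trigc : measurable_fun setT (fun t => trigc (rowt t)).
Proof.
apply: measurable_sum => i; apply: measurable_funM => //.
have := measurable_cos_phase (y i) 0; under eq_fun do rewrite addr0; exact.
Qed.

Lemma measurable_trigs : measurable_fun setT (fun t => trigs (rowt t)).
Proof.
apply: measurable_sum => i; apply: measurable_funM => //.
apply: measurableT_comp; last exact: measurable_dotp.
by apply: continuous_measurable_fun; exact: continuous_sin.
Qed.

End quadratic_form.

(** * Kernel combinations in the native space *)

Section kernel_combination.
Variables (R : realType) (d : nat) (nu : R).
Hypothesis nud : d%:R / 2 < nu.
Local Notation leb := (@tuple_lebesgue R d).
Local Notation Psi := (@Matern R d nu).
Local Notation K := (powR (pi *+ 2) (- (d%:R / 2)) : R).

Lemma FT_const_gt0 : 0 < K.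
Proof. by rewrite powR_gt0// mulrn_wgt0// pi_gt0. Qed.

(** The balance of normalisations: one [K] from the native norm, one left over from
    [(K * khat)^2 / (K * khat)], and [(2 pi)^d] from inversion. *)
Lemma FT_const_sqr : K * K * (2 * pi) ^+ d = 1.
Proof.
have p0 : 0 < pi *+ 2 :> R by rewrite mulrn_wgt0// pi_gt0.
rewrite -powRD; last by rewrite (gt_eqF p0) implybT.
rewrite (_ : _ + _ = - d%:R); last by field.
rewrite powRN powR_mulrn ?ltW// mulr_natl mulVf// gt_eqF// exprn_gt0//.
Qed.

Section hasint_square.
Variable g : 'rV[R]_d -> R.

Lemma square_integrable_bounded (h : 'rV[R]_d -> R) v : Rd_measurable g ->
  hasint leb (fun t => h (rowt t)) v -> (forall x, g x ^+ 2 <= h x) -> square_integrable g.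
Proof.
move=> mg hv gh; split=> //.
have [w gw] : exists w, hasint leb (fun t => g (rowt t) ^+ 2) w.
  apply: dominated_hasint hv _; first exact: measurable_funX.
  by move=> t; rewrite ger0_norm ?sqr_ge0.
by rewrite (iint_hasint gw) ?ltry// => x; exact: sqr_ge0.
Qed.

Lemma integrable1_bounded (h : 'rV[R]_d -> R) v : Rd_measurable g ->
  hasint leb (fun t => h (rowt t)) v -> (forall x, `|g x| <= h x) -> integrable1 g.
Proof.
move=> mg hv gh; split=> //.
have [w gw] : exists w, hasint leb (fun t => `|g (rowt t)|) w.
  apply: dominated_hasint hv _; first exact: measurableT_comp.
  by move=> t; rewrite normr_id.
by rewrite (iint_hasint gw) ?ltry.
Qed.

Lemma square_integrable_hasint : square_integrable g ->
  exists v, hasint leb (fun t => g (rowt t) ^+ 2) v.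
Proof.
move=> [mg goo]; eexists; apply: (hasint_iint (f := fun x => g x ^+ 2)) goo.
  exact: measurable_funX.
by move=> x; exact: sqr_ge0.
Qed.

Lemma integrable1_hasint : integrable1 g ->
  exists v, hasint leb (fun t => `|g (rowt t)|) v.
Proof.
move=> [mg goo]; eexists; apply: (hasint_iint (f := fun x => `|g x|)) goo => //.
exact: measurableT_comp.
Qed.

End hasint_square.

Variables (I : finType) (u : I -> R) (y : I -> 'rV[R]_d).

Definition kernel_comb (x : 'rV[R]_d) := \sum_i u i * Psi (x - y i).

Let U := \sum_i `|u i|.

Let kernel_abs (x : 'rV[R]_d) := \sum_i `|u i| * Psi (x - y i).

Lemma continuous_kernel_comb : continuous kernel_comb.
Proof.
move=> x; apply: (@cvg_sum_fin _ _ (nbhs x)) => i.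
apply: cvgM; first exact: cvg_cst.
apply: (@continuous_cvg _ _ _ (nbhs x) _ (fun x => x - y i) Psi); first exact: continuous_Matern.
by apply: cvgB; [exact: cvg_id | exact: cvg_cst].
Qed.

Lemma measurable_kernel_comb : Rd_measurable kernel_comb.
Proof.
by apply: measurable_sum => i; apply: measurable_funM => //; exact: measurable_Matern.
Qed.

Let kernel_fourier (v : I -> R) w th :
  hasint leb (fun t => (\sum_i v i * Psi (rowt t - y i)) * cos (dotp (rowt t) w + th))
    (khat nu w * \sum_i v i * cos (dotp (y i) w + th)).
Proof.
have := hasint_sum (fun i => hasintZ (v i) (Matern_fourier nud (y i) w th)).
rewrite (_ : \sum_i _ = khat nu w * \sum_i v i * cos (dotp (y i) w + th)).
  apply: hasint_ext => t; rewrite mulr_suml; apply: eq_bigr => i _; ring.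
by rewrite mulr_sumr; apply: eq_bigr => i _; ring.
Qed.

Let hasint_kernel_abs : exists v, hasint leb (fun t => kernel_abs (rowt t)) v.
Proof.
eexists; apply: hasint_ext (kernel_fourier (fun i => `|u i|) 0 0) => t.
by rewrite dotp0r addr0 cos0 mulr1.
Qed.

Let kernel_abs_le x : kernel_abs x <= U.
Proof. by apply: ler_sum => i _; rewrite ler_piMr// Matern_le1. Qed.

Let kernel_comb_le x : `|kernel_comb x| <= kernel_abs x.
Proof.
apply: le_trans (ler_norm_sum _ _ _) _; apply: ler_sum => i _.
by rewrite normrM (ger0_norm (Matern_ge0 _ _)).
Qed.

Let kernel_abs_ge0 x : 0 <= kernel_abs x.
Proof. by apply: sumr_ge0 => i _; rewrite mulr_ge0// Matern_ge0. Qed.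

(** The majorant [kernel_abs] is integrable and bounded by [U], so its square is at most
    [U * kernel_abs]. *)
Lemma square_integrable_kernel_comb : square_integrable kernel_comb.
Proof.
have [v Hv] := hasint_kernel_abs.
apply: (square_integrable_bounded (h := fun x => U * kernel_abs x)
  measurable_kernel_comb (hasintZ U Hv)) => x.
rewrite -real_normK ?num_real// expr2 ler_pM//.
exact: le_trans (kernel_comb_le x) _.
Qed.

(* Fubini: the Fourier transform may be moved from [phi] to the kernel. *)
Lemma kernel_comb_duality (phi : 'rV[R]_d -> R) th : integrable1 phi ->
  exists v (P : 'rV[R]_d -> R),
  [/\ forall x, hasint leb (fun t => phi (rowt t) * cos (dotp (rowt t) x + th)) (P x),
      hasint leb (fun t => kernel_comb (rowt t) * P (rowt t)) v &
      hasint leb (fun t => phi (rowt t) * (khat nu (rowt t) *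
         \sum_i u i * cos (dotp (y i) (rowt t) + th))) v].
Proof.
move=> phi1; have [N HN] := integrable1_hasint phi1; have [A HA] := hasint_kernel_abs.
have mphi : measurable_fun setT (fun t : d.-tuple R => phi (rowt t)) by case: phi1.
have PE x : exists P, hasint leb (fun t => phi (rowt t) * cos (dotp (rowt t) x + th)) P.
  apply: dominated_hasint HN _.
    by apply: measurable_funM => //; exact: measurable_cos_phase.
  by move=> t; rewrite normrM ler_piMr ?normr_cos_le1.
have [P HP] := choice PE.
pose f (x w : d.-tuple R) :=
  kernel_comb (rowt x) * (phi (rowt w) * cos (dotp (rowt w) (rowt x) + th)).
pose g (x w : d.-tuple R) := kernel_abs (rowt x) * `|phi (rowt w)|.
have m1 (h : d.-tuple R -> R) : measurable_fun setT h ->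
    measurable_fun setT (fun z : d.-tuple R * d.-tuple R => h z.1).
  by move=> mh; apply: measurableT_comp.
have m2 (h : d.-tuple R -> R) : measurable_fun setT h ->
    measurable_fun setT (fun z : d.-tuple R * d.-tuple R => h z.2).
  by move=> mh; apply: measurableT_comp.
have mg : measurable_fun setT (fun z : d.-tuple R * d.-tuple R => g z.1 z.2).
  apply: measurable_funM; first exact: (m1 _ (hasint_measurable HA)).
  exact: (m2 _ (hasint_measurable HN)).
have mf : measurable_fun setT (fun z : d.-tuple R * d.-tuple R => f z.1 z.2).
  apply: measurable_funM; first exact: (m1 _ measurable_kernel_comb).
  apply: measurable_funM; first exact: (m2 _ mphi).
  apply: measurableT_comp; first by apply: continuous_measurable_fun; exact: continuous_cos.
  apply: measurable_funD => //; apply: measurable_sum => i.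
  under eq_fun do rewrite !mxE.
  apply: measurable_funM.
    exact: (m2 (fun t => tnth t i) (measurable_tnth i)).
  exact: (m1 (fun t => tnth t i) (measurable_tnth i)).
have fg x w : `|f x w| <= g x w.
  rewrite normrM ler_pM// ?kernel_comb_le//.
  by rewrite normrM ler_piMr ?normr_cos_le1.
have gG x : hasint leb (g x) (kernel_abs (rowt x) * N) by exact: hasintZ.
have GA : hasint leb (fun x => kernel_abs (rowt x) * N) (N * A).
  by apply: hasint_ext (hasintZ N HA) => x; rewrite mulrC.
have fF x : hasint leb (f x) (kernel_comb (rowt x) * P (rowt x)) by exact: hasintZ.
have fH w : hasint leb (f^~ w) (phi (rowt w) * (khat nu (rowt w) *
         \sum_i u i * cos (dotp (y i) (rowt w) + th))).
  apply: hasint_ext (hasintZ (phi (rowt w)) (kernel_fourier u (rowt w) th)) => x.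
  by rewrite /f (dotpC (rowt w)) /kernel_comb; ring.
have [v [H1 H2]] := hasint_swap mf mg fg gG GA fF fH.
by exists v, P; split.
Qed.

Lemma kernel_comb_L2_FT : is_L2_FT kernel_comb
  (fun w => K * khat nu w * trigc u y w) (fun w => - (K * khat nu w * trigs u y w)).
Proof.
have [B HB] := khat_le nud.
have mk := measurable_khat nud.
have hk : hasint leb (fun t => khat nu (rowt t)) ((2 * pi) ^+ d * Psi 0).
  have := khat_fourier nud 0 0; rewrite cos0 mulr1.
  by apply: hasint_ext => t; rewrite dotp0r addr0 cos0 mulr1.
(* [khat] is integrable and bounded by [B], hence [khat^2] is dominated by [B * khat]. *)
have sq (T : 'rV[R]_d -> R) : (forall w, `|T w| <= U) ->
    forall w, (K * khat nu w * T w) ^+ 2 <= K ^+ 2 * U ^+ 2 * B * khat nu w.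
  move=> TU w; have k0 := ltW (khat_gt0 nud w).
  have T2 : T w ^+ 2 <= U ^+ 2.
    by rewrite -[T w ^+ 2]real_normK ?num_real// lerXn2r ?nnegrE// (le_trans _ (TU w)).
  have -> : (K * khat nu w * T w) ^+ 2 = K ^+ 2 * (T w ^+ 2 * (khat nu w * khat nu w)) by ring.
  have -> : K ^+ 2 * U ^+ 2 * B * khat nu w = K ^+ 2 * (U ^+ 2 * (B * khat nu w)) by ring.
  apply: ler_wpM2l; first exact: sqr_ge0.
  apply: ler_pM => //; [exact: sqr_ge0 | exact: mulr_ge0 |].
  exact: ler_wpM2r.
have hkB := hasintZ (K ^+ 2 * U ^+ 2 * B) hk.
split; last split.
- apply: (square_integrable_bounded (h := fun w => K ^+ 2 * U ^+ 2 * B * khat nu w) _ hkB).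
    apply: measurable_funM; last exact: measurable_trigc.
    exact: measurable_funM.
  by apply: sq => w; exact: trigc_norm_le.
- apply: (square_integrable_bounded (h := fun w => K ^+ 2 * U ^+ 2 * B * khat nu w) _ hkB).
    apply: measurableT_comp => //; apply: measurable_funM; last exact: measurable_trigs.
    exact: measurable_funM.
  by move=> w; rewrite sqrrN; apply: sq => {}w; exact: trigs_norm_le.
move=> phi phi1 _; split.
- have [v [P [HP H1 H2]]] := kernel_comb_duality 0 phi1.
  have FE : (fun x => kernel_comb x * FT_re phi x) = (fun x => K * (kernel_comb x * P x)).
    apply/funext => x; rewrite /FT_re (@Rint_hasint _ _ _ (P x))/=; first by rewrite mulrCA.
    by apply: hasint_ext (HP x) => t; rewrite addr0.
  rewrite FE (Rint_hasint (hasintZ K H1)); apply: Rint_hasint.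
  apply: hasint_ext (hasintZ K H2) => t; rewrite /trigc.
  under eq_bigr do rewrite addr0 dotpC.
  by ring.
(* The phase [- (pi / 2)] turns every cosine of the duality into a sine. *)
- have [v [P [HP H1 H2]]] := kernel_comb_duality (- (pi / 2)) phi1.
  have FE : (fun x => kernel_comb x * FT_im phi x) = (fun x => - K * (kernel_comb x * P x)).
    apply/funext => x; rewrite /FT_im (@Rint_hasint _ _ _ (P x))/=; first by ring.
    by apply: hasint_ext (HP x) => t; rewrite cosBpihalf.
  rewrite FE (Rint_hasint (hasintZ (- K) H1)); apply: Rint_hasint.
  apply: hasint_ext (hasintZ (- K) H2) => t; rewrite /trigs.
  under eq_bigr do rewrite cosBpihalf dotpC.
  by ring.
Qed.

Lemma kernel_comb_native : native_sqnorm_is Psi kernel_comb (qform nu u y).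
Proof.
split; first exact: continuous_kernel_comb.
split; first exact: square_integrable_kernel_comb.
exists (fun w => K * khat nu w * trigc u y w), (fun w => - (K * khat nu w * trigs u y w)).
split; first exact: kernel_comb_L2_FT.
have E w : ((K * khat nu w * trigc u y w) ^+ 2 + (- (K * khat nu w * trigs u y w)) ^+ 2) /
    FT_re Psi w = K * (khat nu w * (trigc u y w ^+ 2 + trigs u y w ^+ 2)).
  rewrite FT_re_Matern//; field.
  by rewrite !gt_eqF ?khat_gt0 ?FT_const_gt0.
rewrite (funext E); have H := hasintZ K (hasint_qform nud u y).
have pos w : 0 <= K * (khat nu w * (trigc u y w ^+ 2 + trigs u y w ^+ 2)).
  by rewrite !mulr_ge0 ?trig_sqr_ge0 ?ltW ?khat_gt0 ?FT_const_gt0.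
split; first exact: hasint_measurable H.
under eq_fun do rewrite E.
have IE := iint_hasint
  (f := fun w => K * (khat nu w * (trigc u y w ^+ 2 + trigs u y w ^+ 2))) H pos.
split; first by rewrite IE ltry.
by rewrite IE /= !mulrA FT_const_sqr mul1r.
Qed.

End kernel_combination.

(** * Point evaluations in the native space *)

Section mollifier.
Variables (R : realType) (d : nat).
Local Notation leb := (@tuple_lebesgue R d).

Lemma hasint_norm_le e (T : measurableType e) (mu : {measure set T -> \bar R})
    (f g : T -> R) v w :
  hasint mu f v -> hasint mu g w -> (forall x, `|f x| <= g x) -> `|v| <= w.
Proof.
move=> fv gw fg; rewrite ler_norml; apply/andP; split.
  rewrite lerNl -mulN1r; apply: (hasint_le (hasintZ (-1) fv) gw) => x.
  by rewrite mulN1r (le_trans _ (fg x))// -normrN ler_norm.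
by apply: (hasint_le fv gw) => x; rewrite (le_trans _ (fg x))// ler_norm.
Qed.

(* The normalisation makes [Num.sqrt (4 * pi * width k)] equal to [k.+1%:R^-1]. *)
Definition width (k : nat) : R := (4 * pi * k.+1%:R ^+ 2)^-1.

Lemma width_gt0 k : 0 < width k.
Proof. by rewrite invr_gt0 mulr_gt0// ?exprn_gt0// mulr_gt0// pi_gt0. Qed.

Lemma expr_expR_cvg0 (c : R) : 0 < c ->
  k.+1%:R ^+ d * expR (- (c * k.+1%:R ^+ 2)) @[k --> \oo] --> (0 : R).
Proof.
(* Writing D for [d + 1] and n for [k + 1], one has [expR (c n^2) >= (c n^2 / D)^D >= (c n / D)^D],
   so the term is at most [A / n]. *)
move=> c0; pose A : R := (d.+1%:R / c) ^+ d.+1.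
have A0 : 0 <= A by rewrite exprn_ge0// divr_ge0// ltW.
have H : A * k.+1%:R^-1 @[k --> \oo] --> (0 : R).
  by rewrite -(mulr0 A); apply: cvgM; [exact: cvg_cst | exact: cvg_harmonic].
apply: (@squeeze_cvgr _ _ _ _ (fun=> 0) _ _ _ _ _ H); last exact: cvg_cst.
apply: nearW => k; rewrite mulr_ge0 ?exprn_ge0 ?expR_ge0//=.
set n : R := k.+1%:R; have n0 : 0 < n by rewrite ltr0n.
have n1 : 1 <= n by rewrite ler1n.
rewrite expRN ler_pdivrMr ?expR_gt0//.
have D0 : d.+1%:R != 0 :> R by rewrite pnatr_eq0.
have E : (c * n / d.+1%:R) ^+ d.+1 <= expR (c * n ^+ 2).
  rewrite (_ : c * n ^+ 2 = d.+1%:R * (c * n ^+ 2 / d.+1%:R)); last by rewrite [RHS]mulrC divfK.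
  rewrite expRM_natl; apply: lerXn2r; rewrite ?nnegrE ?expR_ge0//.
    by rewrite divr_ge0// mulr_ge0 ?ltW.
  apply: (@le_trans _ _ (1 + c * n ^+ 2 / d.+1%:R)); last exact: expR_ge1Dx.
  rewrite -[leLHS]add0r lerD// ler_wpM2r// ?invr_ge0// ler_wpM2l ?(ltW c0)//.
  by rewrite expr2 ler_peMl// ltW.
apply: le_trans (_ : A / n * (c * n / d.+1%:R) ^+ d.+1 <= _); last first.
  by apply: ler_wpM2l => //; rewrite divr_ge0// ltW.
rewrite mulrAC /A -exprMn (_ : d.+1%:R / c * (c * n / d.+1%:R) = n); last first.
  by rewrite mulrA mulrA divfK ?gt_eqF// mulrAC mulfV// mul1r.
by rewrite exprSr mulfK// gt_eqF.
Qed.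

Variables (F : 'rV[R]_d -> R) (y : 'rV[R]_d) (N : R).
Hypothesis FN : hasint leb (fun t => F (rowt t) ^+ 2) N.
Hypothesis mF : Rd_measurable F.

Local Notation bump s t := (expR (- (sqn (rowt t - y) / (4 * s)))).

Lemma hasint_bump (s : R) : 0 < s ->
  hasint leb (fun t => bump s t) (Num.sqrt (4 * pi * s) ^+ d).
Proof.
move=> s0; have := hasint_gauss_row y 0 0 s0.
rewrite sqn0 mulr0 oppr0 expR0 mulr1 dotp0r addr0 cos0 mulr1.
by apply: hasint_ext => t; rewrite dotp0r addr0 cos0 mulr1.
Qed.

Lemma hasint_mollify (s : R) : 0 < s ->
  exists v, hasint leb (fun t => F (rowt t) * bump s t) v.
Proof.
move=> s0; apply: dominated_hasint (hasintD FN (hasint_bump s0)) _.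
  by apply: measurable_funM => //; exact: hasint_measurable (hasint_bump s0).
move=> t; set b := bump s t; rewrite normrM.
have b0 : 0 < b by exact: expR_gt0.
have b1 : b <= 1.
  by rewrite -expR0 ler_expR oppr_le0 divr_ge0 ?sqn_ge0// mulr_ge0 ?ltW.
rewrite (gtr0_norm b0) -[F (rowt t) ^+ 2]real_normK ?num_real//.
have := sqr_ge0 (`|F (rowt t)| - 1); have := normr_ge0 (F (rowt t)); nra.
Qed.

(** Rows carry the sup norm, while bumps are Euclidean; each squared coordinate of [x - y] is at
    most [sqn (x - y)], so a Euclidean ball fits in every neighbourhood. *)
Lemma near_sqn (e : R) : continuous F -> 0 < e ->
  exists2 dl, 0 < dl & forall x, sqn (x - y) < dl -> `|F x - F y| <= e.
Proof.
move=> cF e0; have /cvgrPdist_le/(_ e e0) := cF y.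
move=> /nbhs_ballP[r /= r0 rF]; exists (r ^+ 2); first by rewrite exprn_gt0.
move=> x xr; rewrite distrC; apply: rF; split=> // i j; rewrite /ball/= ord1.
rewrite -ltr_sqr ?nnegrE ?(ltW r0)// real_normK ?num_real//; apply: le_lt_trans xr.
rewrite /sqn (bigD1 j)//= !mxE -sqrrN opprB lerDl.
by apply: sumr_ge0 => k _; exact: sqr_ge0.
Qed.

Lemma mollify_cvg (m : R -> R) : continuous F ->
  (forall s, 0 < s -> hasint leb (fun t => F (rowt t) * bump s t) (m s)) ->
  k.+1%:R ^+ d * m (width k) @[k --> \oo] --> F y.
Proof.
move=> cF Fm; apply/cvgrPdist_le => e e0.
have e20 : 0 < e / 2 by rewrite divr_gt0.
have [dl dl0 Fdl] := near_sqn cF e20.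
have N0 : 0 <= N by apply: (hasint_ge0 FN) => t; exact: sqr_ge0.
pose B := 1 + `|F y|; have B0 : 0 <= B by rewrite addr_ge0.
(* For [s = width k] and [n = k.+1], [1 / (4 * s)] is [pi * n^2], so [c * n^2] is
   [dl / (4 * (2 * s))]: the exponent of the bump of width [2 * s] where [sqn (x - y) = dl]. *)
pose c := dl * pi / 2; have c0 : 0 < c by rewrite divr_gt0// mulr_gt0// pi_gt0.
pose C := N + B * Num.sqrt 2 ^+ d + 1.
have C0 : 0 < C by rewrite ltr_wpDl// addr_ge0// mulr_ge0// exprn_ge0.
have /cvgr0Pnorm_le/(_ (e / 2 / C)) := expr_expR_cvg0 c0.
rewrite divr_gt0// => /(_ isT); apply: filterS => k.
set n : R := k.+1%:R; have n0 : 0 < n by rewrite ltr0n.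
have n1 : 1 <= n by rewrite ler1n.
rewrite ger0_norm ?mulr_ge0 ?exprn_ge0 ?expR_ge0 ?(ltW n0)// => small.
have s0 := width_gt0 k; set s := width k in s0 *.
have g1 (p q : R) : 0 < p -> 0 < q -> 4 * p * (4 * p * q ^+ 2)^-1 = q^-1 ^+ 2.
  by move=> p0 q0; field; rewrite !gt_eqF.
have g2 (p q l : R) : 0 < p -> 0 < q -> l / (4 * (4 * p * q ^+ 2)^-1) = 2 * (l * p / 2 * q ^+ 2).
  by move=> p0 q0; field; rewrite !gt_eqF.
have sE : 4 * pi * s = n^-1 ^+ 2 by rewrite /s /width g1 ?pi_gt0.
have s2E : 4 * pi * (2 * s) = 2 * n^-1 ^+ 2 by rewrite -sE; ring.
have dE : dl / (4 * s) = 2 * (c * n ^+ 2) by rewrite /s /width g2 ?pi_gt0.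
have ni0 : 0 <= n^-1 by rewrite invr_ge0 ltW.
clearbody c s n; have H1 := hasint_bump s0; rewrite sE sqrtr_sqr (ger0_norm ni0) in H1.
have s20 : 0 < 2 * s by rewrite mulr_gt0.
have H2 := hasint_bump s20; rewrite s2E sqrtrM// sqrtr_sqr (ger0_norm ni0) exprMn in H2.
have HL := hasintB (Fm s s0) (hasintZ (F y) H1).
pose E := expR (- (c * n ^+ 2)).
have HR := hasintD (hasintD (hasintZ (e / 2) H1) (hasintZ E FN)) (hasintZ (B * E) H2).
have E0 : 0 < E by exact: expR_gt0.
have E1 : E <= 1 by rewrite -expR0 ler_expR oppr_le0 mulr_ge0 ?sqr_ge0 ?ltW.
have := hasint_norm_le HL HR _.
have bump0 r t : 0 < bump r t by exact: expR_gt0.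
have pt t : `|F (rowt t) * bump s t - F y * bump s t| <=
    e / 2 * bump s t + E * F (rowt t) ^+ 2 + B * E * bump (2 * s) t.
  rewrite -mulrBl normrM (gtr0_norm (bump0 s t)).
  have [near_y|far_y] := ltP (sqn (rowt t - y)) dl.
    rewrite -addrA -[leLHS]addr0 lerD ?ler_wpM2r ?(ltW (bump0 s t)) ?Fdl//.
    apply: addr_ge0; [apply: mulr_ge0; [exact: ltW | exact: sqr_ge0]|].
    by apply: mulr_ge0; [apply: mulr_ge0 => //; exact: ltW | exact: expR_ge0].
  (* Far from [y] one of the two wider bumps is at most [E], uniformly; the other one keeps the
     constant [B] integrable, while [F^2] is integrable by itself. *)
  have bs : bump s t = bump (2 * s) t * bump (2 * s) t.
    by rewrite -expRD; congr expR; field; rewrite gt_eqF.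
  have b2E : bump (2 * s) t <= E.
    rewrite ler_expR lerN2.
    have -> : c * n ^+ 2 = dl / (4 * (2 * s)).
      transitivity (dl / (4 * s) / 2); first by rewrite dE; field.
      by field; rewrite gt_eqF.
    by rewrite ler_pM2r// invr_gt0 mulr_gt0.
  have bE : bump s t <= E.
    rewrite bs; apply: le_trans (b2E); rewrite ler_piMr ?expR_ge0//.
    exact: le_trans E1.
  have bBE : bump s t <= E * bump (2 * s) t by rewrite bs ler_wpM2r// ltW.
  apply: (@le_trans _ _ ((F (rowt t) ^+ 2 + B) * bump s t)).
    rewrite ler_wpM2r ?(ltW (bump0 s t))// (le_trans (ler_normB _ _))// /B addrA lerD2r.
    have := sqr_ge0 (`|F (rowt t)| - 1).
    rewrite -[F (rowt t) ^+ 2]real_normK ?num_real//; have := normr_ge0 (F (rowt t)); nra.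
  rewrite mulrDl -addrA -[leLHS]add0r; apply: lerD; first by rewrite mulr_ge0 ?expR_ge0 ?(ltW e20).
  apply: lerD; first by rewrite mulrC ler_wpM2r ?sqr_ge0.
  by rewrite -mulrA ler_wpM2l.
move=> /(_ pt) bnd.
have nd0 : 0 < n ^+ d by rewrite exprn_gt0.
have -> : F y - n ^+ d * m s = - (n ^+ d * (m s - F y * n^-1 ^+ d)).
  by rewrite mulrBr mulrCA -exprMn mulfV ?gt_eqF// expr1n mulr1 opprB.
rewrite normrN normrM (gtr0_norm nd0).
apply: le_trans (ler_wpM2l (ltW nd0) bnd) _.
have nE : n ^+ d * n^-1 ^+ d = 1 by rewrite -exprMn mulfV ?gt_eqF// expr1n.
have -> : n ^+ d * (e / 2 * n^-1 ^+ d + E * N + B * E * (Num.sqrt 2 ^+ d * n^-1 ^+ d)) =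
    (n ^+ d * n^-1 ^+ d) * (e / 2) + n ^+ d * E * N +
    (n ^+ d * n^-1 ^+ d) * (E * (B * Num.sqrt 2 ^+ d)).
  by ring.
rewrite nE !mul1r [leRHS]splitr -addrA lerD2l.
apply: (@le_trans _ _ (n ^+ d * E * (N + B * Num.sqrt 2 ^+ d))).
  rewrite mulrDr lerD2l ler_wpM2r ?mulr_ge0 ?exprn_ge0//.
  by rewrite ler_peMl ?(ltW E0)// exprn_ege1.
apply: (@le_trans _ _ (n ^+ d * E * C)).
  by rewrite ler_wpM2l ?mulr_ge0 ?(ltW nd0) ?(ltW E0)// /C lerDl.
by rewrite -ler_pdivlMr.
Qed.

End mollifier.

(** Recovers the Cauchy-Schwarz form from a family of weighted inequalities by choosing
    [l = |S| / v]. If [v = 0], the weight [(Q + 1) / |S|] forces [S = 0]. *)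
Lemma le_mul_of_weighted (R : realType) (S v Q : R) : 0 <= v -> 0 <= Q ->
  (forall l : R, 0 < l -> `|S| <= l / 2 * v + Q / (2 * l)) -> S ^+ 2 <= v * Q.
Proof.
move=> v0 Q0 H; rewrite -[S ^+ 2]real_normK ?num_real//.
have [S0|S0] := eqVneq `|S| 0; first by rewrite S0 expr0n mulr_ge0.
have {}S0 : 0 < `|S| by rewrite lt_neqAle eq_sym S0 normr_ge0.
set s := `|S| in H S0 *.
have [v00|v00] := eqVneq v 0.
  have := H ((Q + 1) / s); rewrite v00 divr_gt0 ?ltr_wpDl// => /(_ isT).
  rewrite mulr0 add0r (_ : Q / _ = s / 2 * (Q / (Q + 1))).
    move=> h; exfalso; have : s / 2 * (Q / (Q + 1)) <= s / 2.
      by rewrite ler_piMr ?divr_ge0 ?(ltW S0)// ler_pdivrMr ?ltr_wpDl// mul1r lerDl.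
    by move/(le_trans h); rewrite ler_pdivlMr// ger_pMr// lern1.
  by field; rewrite !gt_eqF// ltr_wpDl.
have {}v00 : 0 < v by rewrite lt_neqAle eq_sym v00 v0.
have := H (s / v); rewrite divr_gt0// => /(_ isT).
rewrite (_ : s / v / 2 * v + _ = s / 2 + v * Q / (2 * s)); last by field; rewrite !gt_eqF.
move=> h; have : s / 2 <= v * Q / (2 * s) by lra.
by rewrite ler_pdivlMr ?mulr_gt0// (_ : s / 2 * (2 * s) = s ^+ 2)//; field.
Qed.

Section native_bound.
Variables (R : realType) (d : nat) (nu : R).
Hypothesis nud : d%:R / 2 < nu.
Local Notation leb := (@tuple_lebesgue R d).
Local Notation Psi := (@Matern R d nu).
Local Notation K := (powR (pi *+ 2) (- (d%:R / 2)) : R).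
Variables (I : finType).

Section damped_test_function.
Variables (u : I -> R) (y : I -> 'rV[R]_d) (s : R).
Hypothesis s0 : 0 < s.
Let U := \sum_i `|u i|.
Let D := Num.sqrt (pi / s) ^+ d.
Definition damp (w : 'rV[R]_d) := expR (- (sqn w * s)).

Let bmp (x z : 'rV[R]_d) := expR (- (sqn (x - z) / (4 * s))).

Lemma hasint_damp (x : 'rV[R]_d) :
  hasint leb (fun t => damp (rowt t) * cos (dotp (rowt t) x)) (D * expR (- (sqn x / (4 * s)))).
Proof.
have r0 : 0 < (4 * s)^-1 by rewrite invr_gt0 mulr_gt0.
have := hasint_gauss_row 0 x 0 r0; rewrite dotp0l addr0 cos0 mulr1.
have h (p : R) : 4 * p / (4 * s) = p / s by field; rewrite gt_eqF.
rewrite h -/D (mulrC _ (sqn x)); apply: hasint_ext => t.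
rewrite addr0 subr0 /damp; congr (expR (- (_ * _)) * _).
by field; rewrite gt_eqF.
Qed.

Lemma damp_gt0 w : 0 < damp w. Proof. exact: expR_gt0. Qed.

Lemma damp_le1 w : damp w <= 1.
Proof. by rewrite -expR0 ler_expR oppr_le0 mulr_ge0 ?sqn_ge0 ?(ltW s0). Qed.

Lemma hasint_damp0 : hasint leb (fun t => damp (rowt t)) D.
Proof.
have := hasint_damp 0; rewrite sqn0 mul0r oppr0 expR0 mulr1.
by apply: hasint_ext => t; rewrite dotp0r cos0 mulr1.
Qed.

Let mdamp := hasint_measurable hasint_damp0.

Lemma damped_integrable (T : 'rV[R]_d -> R) :
  measurable_fun setT (fun t => T (rowt t)) -> (forall w, `|T w| <= U) ->
  integrable1 (fun w => damp w * T w) /\ square_integrable (fun w => damp w * T w).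
Proof.
move=> mT TU; have mp : Rd_measurable (fun w => damp w * T w) by exact: measurable_funM.
split.
  apply: (integrable1_bounded (h := fun w => U * damp w) mp (hasintZ U hasint_damp0)) => w.
  by rewrite normrM (gtr0_norm (damp_gt0 w)) mulrC ler_wpM2r ?(ltW (damp_gt0 w)).
apply: (square_integrable_bounded (h := fun w => U ^+ 2 * damp w) mp
  (hasintZ (U ^+ 2) hasint_damp0)) => w.
have d0 := ltW (damp_gt0 w).
rewrite exprMn mulrC; apply: ler_pM; rewrite ?sqr_ge0//.
  by rewrite -[T w ^+ 2]real_normK ?num_real// lerXn2r ?nnegrE// (le_trans _ (TU w)).
by rewrite expr2 ler_piMr// damp_le1.
Qed.

(** The product of two cosines is half the sum of the cosines of the difference and the sum of the
    angles, which places a bump at [y i] and one at [- y i]. The sine version gives the second one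
    the opposite sign. *)
Lemma hasint_damped_cos x :
  hasint leb (fun t => damp (rowt t) * trigc u y (rowt t) * cos (dotp (rowt t) x))
    (D / 2 * \sum_i u i * (bmp x (y i) + bmp x (- y i))).
Proof.
have H := hasint_sum (fun i => hasintZ (u i / 2)
  (hasintD (hasint_damp (x - y i)) (hasint_damp (x - - y i)))).
rewrite (_ : \sum_i _ = D / 2 * \sum_i u i * (bmp x (y i) + bmp x (- y i))) in H; last first.
  by rewrite mulr_sumr; apply: eq_bigr => i _; rewrite /bmp; ring.
apply: hasint_ext H => t; rewrite -mulrA mulr_suml mulr_sumr; apply: eq_bigr => i _.
have -> : dotp (rowt t) (x - - y i) = dotp (rowt t) x + dotp (rowt t) (y i).
  by rewrite !dotpBr -[- y i]sub0r dotpBr dotp0r sub0r opprK.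
by rewrite dotpBr cosB cosD; field.
Qed.

Lemma hasint_damped_sin x :
  hasint leb (fun t => damp (rowt t) * trigs u y (rowt t) * sin (dotp (rowt t) x))
    (D / 2 * \sum_i u i * (bmp x (y i) - bmp x (- y i))).
Proof.
have H := hasint_sum (fun i => hasintZ (u i / 2)
  (hasintB (hasint_damp (x - y i)) (hasint_damp (x - - y i)))).
rewrite (_ : \sum_i _ = D / 2 * \sum_i u i * (bmp x (y i) - bmp x (- y i))) in H; last first.
  by rewrite mulr_sumr; apply: eq_bigr => i _; rewrite /bmp; ring.
apply: hasint_ext H => t; rewrite -mulrA mulr_suml mulr_sumr; apply: eq_bigr => i _.
have -> : dotp (rowt t) (x - - y i) = dotp (rowt t) x + dotp (rowt t) (y i).
  by rewrite !dotpBr -[- y i]sub0r dotpBr dotp0r sub0r opprK.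
by rewrite dotpBr cosB cosD; field.
Qed.

(** [Ac] yields [P i + M i] and [As] yields [M i - P i], both with the factor [K * D / 2];
    subtracting removes the averages [M i] around [- y i]. *)
Lemma damped_FT (F gr gi : 'rV[R]_d -> R) (P M : I -> R) (Ac As : R) :
  is_L2_FT F gr gi ->
  (forall i, hasint leb (fun t => F (rowt t) * bmp (rowt t) (y i)) (P i)) ->
  (forall i, hasint leb (fun t => F (rowt t) * bmp (rowt t) (- y i)) (M i)) ->
  hasint leb (fun t => gr (rowt t) * (damp (rowt t) * trigc u y (rowt t))) Ac ->
  hasint leb (fun t => gi (rowt t) * (damp (rowt t) * trigs u y (rowt t))) As ->
  Ac - As = K * D * \sum_i u i * P i.
Proof.
move=> [_ [_ dual]] HP HM HAc HAs.
have [c1 c2] := damped_integrable (measurable_trigc u y) (trigc_norm_le u y).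
have [s1 s2] := damped_integrable (measurable_trigs u y) (trigs_norm_le u y).
have [+ _] := dual _ c1 c2.
have [_ +] := dual _ s1 s2.
rewrite (Rint_hasint (f := fun w => gr w * (damp w * trigc u y w)) HAc).
rewrite (Rint_hasint (f := fun w => gi w * (damp w * trigs u y w)) HAs).
have -> : (fun x => F x * FT_im (fun w => damp w * trigs u y w) x) =
    (fun x => - (K * D / 2) * \sum_i u i * (F x * bmp x (y i) - F x * bmp x (- y i))).
  apply/funext => x; rewrite /FT_im (Rint_hasint (hasint_damped_sin x))/=.
  rewrite (_ : \sum_i u i * (F x * _ - _) = F x * \sum_i u i * (bmp x (y i) - bmp x (- y i))).
    by ring.
  by rewrite mulr_sumr; apply: eq_bigr => i _; ring.
have -> : (fun x => F x * FT_re (fun w => damp w * trigc u y w) x) =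
    (fun x => K * D / 2 * \sum_i u i * (F x * bmp x (y i) + F x * bmp x (- y i))).
  apply/funext => x; rewrite /FT_re (Rint_hasint (hasint_damped_cos x))/=.
  rewrite (_ : \sum_i u i * (F x * _ + _) = F x * \sum_i u i * (bmp x (y i) + bmp x (- y i))).
    by ring.
  by rewrite mulr_sumr; apply: eq_bigr => i _; ring.
have Hp := hasintZ (K * D / 2) (hasint_sum (fun i => hasintZ (u i) (hasintD (HP i) (HM i)))).
have Hm := hasintZ (- (K * D / 2)) (hasint_sum (fun i => hasintZ (u i) (hasintB (HP i) (HM i)))).
rewrite (Rint_hasint (f := fun x => K * D / 2 *
  \sum_i u i * (F x * bmp x (y i) + F x * bmp x (- y i))) Hp).
rewrite (Rint_hasint (f := fun x => - (K * D / 2) *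
  \sum_i u i * (F x * bmp x (y i) - F x * bmp x (- y i))) Hm).
move=> [->] [->].
rewrite mulNr opprK -mulrDr -big_split/= [in RHS]mulr_sumr mulr_sumr.
by apply: eq_bigr => i _; field.
Qed.

End damped_test_function.

Lemma native_bound_weighted (u : I -> R) (y : I -> 'rV[R]_d) F v (l : R) :
  native_sqnorm_is Psi F v -> 0 < l ->
  \sum_i u i * F (y i) <= l / 2 * v + qform nu u y / (2 * l).
Proof.
move=> [cF [F2 [gr [gi [FT [mV [Voo ->]]]]]]] l0.
have K0 : 0 < K by exact: FT_const_gt0.
pose h (w : 'rV[R]_d) := K * khat nu w.
have h0 w : 0 < h w by rewrite mulr_gt0 ?khat_gt0.
have hE w : FT_re Psi w = h w by exact: FT_re_Matern.
have HV := hasint_iint (f := fun w => (gr w ^+ 2 + gi w ^+ 2) / FT_re Psi w) mV _ Voo.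
set V := fine _ in HV *.
have {}HV : hasint leb (fun t => (gr (rowt t) ^+ 2 + gi (rowt t) ^+ 2) / h (rowt t)) V.
  have := HV _; under eq_fun do rewrite hE; apply => w.
  by rewrite hE divr_ge0 ?addr_ge0 ?sqr_ge0 ?(ltW (h0 w)).
have HQ := hasintZ K (hasint_qform nud u y).
have [N HN] := square_integrable_hasint F2.
have mF : Rd_measurable F by case: F2.
have [Ngr HNgr] := square_integrable_hasint FT.1.
have [Ngi HNgi] := square_integrable_hasint FT.2.1.
have mgr : Rd_measurable gr by case: FT.1.
have mgi : Rd_measurable gi by case: FT.2.1.
pose m z s := fine (\int[leb]_t (F (rowt t) * expR (- (sqn (rowt t - z) / (4 * s))))%:E)%E.
have Hm z s : 0 < s ->
    hasint leb (fun t => F (rowt t) * expR (- (sqn (rowt t - z) / (4 * s)))) (m z s).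
  by move=> s0; have [w [wi _]] := hasint_mollify z HN mF s0; exact: hasintP wi.
(* The factor [D] of [damped_FT] equals [(2 pi)^d * k.+1^d] for width [k]; the power of [k.+1]
   normalises the mollifier and [c] collects the rest. The same [c] is the factor of [qform] in
   [HQ]. *)
pose c := K * (2 * pi) ^+ d.
have c0 : 0 < c by rewrite mulr_gt0// exprn_gt0// mulr_gt0// pi_gt0.
have step k : c * \sum_i u i * (k.+1%:R ^+ d * m (y i) (width R k)) <=
    l / 2 * V + c * qform nu u y / (2 * l).
  have s0 := width_gt0 R k; set s := width R k in s0 *.
  have [c1 c2] := damped_integrable s0 (measurable_trigc u y) (trigc_norm_le u y).
  have [s1 s2] := damped_integrable s0 (measurable_trigs u y) (trigs_norm_le u y).
  have prod (g T : 'rV[R]_d -> R) Ng : Rd_measurable g ->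
      hasint leb (fun t => g (rowt t) ^+ 2) Ng -> square_integrable T ->
      exists A, hasint leb (fun t => g (rowt t) * T (rowt t)) A.
    move=> mg Hg T2; have [Nt Ht] := square_integrable_hasint T2.
    apply: dominated_hasint (hasintD Hg Ht) _.
      by apply: measurable_funM => //; case: T2.
    move=> t; rewrite normrM -[g _ ^+ 2]real_normK ?num_real// -[T _ ^+ 2]real_normK ?num_real//.
    have := sqr_ge0 (`|g (rowt t)| - `|T (rowt t)|).
    have := normr_ge0 (g (rowt t)); have := normr_ge0 (T (rowt t)); nra.
  have [Ac HAc] := prod _ _ _ mgr HNgr c2.
  have [As HAs] := prod _ _ _ mgi HNgi s2.
  have := damped_FT s0 FT (fun i => Hm (y i) s s0) (fun i => Hm (- y i) s s0) HAc HAs.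
  have -> : Num.sqrt (pi / s) = 2 * pi * k.+1%:R.
    have pE (p n : R) : 0 < p -> 0 < n -> p / (4 * p * n ^+ 2)^-1 = (2 * p * n) ^+ 2.
      by move=> p0 n0; field; rewrite !gt_eqF.
    by rewrite /s /width pE ?pi_gt0// sqrtr_sqr ger0_norm// !mulr_ge0// pi_ge0.
  rewrite exprMn => E.
  have -> : c * \sum_i u i * (k.+1%:R ^+ d * m (y i) s) = Ac - As.
    rewrite E /c mulrA -[RHS]mulrA [k.+1%:R ^+ d * _]mulr_sumr; congr (_ * _).
    by apply: eq_bigr => i _; rewrite mulrCA.
  have := hasint_le (hasintB HAc HAs) (hasintD (hasintZ (l / 2) HV) (hasintZ (2 * l)^-1 HQ)) _.
  rewrite (_ : (2 * l)^-1 * _ = c * qform nu u y / (2 * l)); last by rewrite /c; ring.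
  apply => t; set w := rowt t.
  have d0 := damp_gt0 s w; have d1 := damp_le1 s0 w.
  (* A completed square with weight [h w]: after integration the first term yields the native norm
     and the second the quadratic form, while [l] stays free for optimisation. *)
  have young (p q : R) : p * q <= l / 2 * (p ^+ 2 / h w) + (2 * l)^-1 * (h w * q ^+ 2).
    have : 0 <= h w / (2 * l) * (l * p / h w - q) ^+ 2.
      apply: mulr_ge0; last exact: sqr_ge0.
      by apply: divr_ge0; [exact: ltW | rewrite mulr_ge0 ?(ltW l0)].
    rewrite (_ : h w / _ * _ = l / 2 * (p ^+ 2 / h w) + (2 * l)^-1 * (h w * q ^+ 2) - p * q).
      by rewrite subr_ge0.
    by field; rewrite !gt_eqF.
  have dsq (T : R) : (damp s w * T) ^+ 2 <= T ^+ 2.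
    by rewrite exprMn ler_piMl ?sqr_ge0// exprn_ile1// ltW.
  have y1 := young (gr w) (damp s w * trigc u y w).
  have y2 := young (gi w) (- (damp s w * trigs u y w)).
  rewrite mulrN sqrrN in y2.
  apply: le_trans (lerD y1 y2) _.
  rewrite addrACA -mulrDr -mulrDl lerD2l -mulrDr -mulrDr.
  rewrite ler_wpM2l ?invr_ge0 ?mulr_ge0 ?(ltW l0)// /h -mulrA ler_wpM2l ?(ltW K0)//.
  by rewrite ler_wpM2l ?(ltW (khat_gt0 nud w))// lerD.
have lim : c * \sum_i u i * (k.+1%:R ^+ d * m (y i) (width R k)) @[k --> \oo] -->
    c * \sum_i u i * F (y i).
  apply: cvgM; first exact: cvg_cst.
  apply: cvg_sum_fin => i; apply: cvgM; first exact: cvg_cst.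
  exact: (mollify_cvg HN cF (Hm (y i))).
have LE : c * \sum_i u i * F (y i) <= l / 2 * V + c * qform nu u y / (2 * l).
  by apply: (cvgr_to_le lim); exact: nearW.
have KK : K * c = 1 by rewrite /c mulrA FT_const_sqr.
move: LE => /(ler_wpM2l (ltW K0)).
have e1 (x : R) : K * (c * x) = x by rewrite mulrA KK mul1r.
by rewrite e1 mulrDr -[c * qform _ _ _ / _]mulrA e1 mulrCA.
Qed.

Lemma native_sqnorm_ge0 F v : native_sqnorm_is Psi F v -> 0 <= v.
Proof.
move=> [_ [_ [gr [gi [_ [mV [Voo ->]]]]]]].
rewrite mulr_ge0 ?(ltW (FT_const_gt0 _ _))//.
have pos w : 0 <= (gr w ^+ 2 + gi w ^+ 2) / FT_re Psi w.
  rewrite FT_re_Matern// divr_ge0 ?addr_ge0 ?sqr_ge0// mulr_ge0//.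
    exact/ltW/FT_const_gt0.
  exact/ltW/khat_gt0.
exact: (hasint_ge0 (hasint_iint mV pos Voo)).
Qed.

Lemma native_bound (u : I -> R) (y : I -> 'rV[R]_d) F v :
  native_sqnorm_is Psi F v -> (\sum_i u i * F (y i)) ^+ 2 <= v * qform nu u y.
Proof.
move=> Fv; apply: le_mul_of_weighted.
- exact: native_sqnorm_ge0 Fv.
- exact: qform_ge0.
move=> l l0; rewrite ler_norml native_bound_weighted// andbT lerNl.
have := native_bound_weighted (fun i => - u i) y Fv l0.
rewrite (_ : qform nu (fun i => - u i) y = qform nu u y).
  by rewrite -sumrN; under eq_bigr do rewrite mulNr.
by apply: eq_bigr => i _; apply: eq_bigr => j _; rewrite mulrNN.
Qed.

End native_bound.

(** * Interpolation error *)

Section kriging.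
Variables (R : realType) (d : nat) (nu : R).
Hypothesis nud : d%:R / 2 < nu.
Local Notation Psi := (@Matern R d nu).
Variables (n : nat) (X : 'I_n -> 'rV[R]_d).
Hypothesis X_inj : injective X.

Lemma kmat_sym : (kmat Psi X)^T = kmat Psi X.
Proof. by apply/matrixP => i j; rewrite !mxE -opprB MaternN. Qed.

Lemma kmat_unit : kmat Psi X \in unitmx.
Proof.
rewrite -row_free_unit -kermx_eq0; apply/eqP; apply/eqP/negPn/negP => /rowV0Pn[v vK v0].
have vR : v *m kmat Psi X = 0 by exact/sub_kermxP.
have [i vi] : exists i, v 0 i != 0.
  apply/existsP; apply: contraNT v0 => /existsPn v0; apply/eqP/rowP => i.
  by rewrite mxE; have := v0 i; rewrite negbK => /eqP.
have := qform_gt0 nud (u := v 0) X_inj (ex_intro _ i vi).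
rewrite (_ : qform nu (v 0) X = (v *m kmat Psi X *m v^T) 0 0); last first.
  rewrite mxE /qform exchange_big; apply: eq_bigr => j _; rewrite !mxE mulr_suml.
  by apply: eq_bigr => k _; rewrite mxE mulrAC.
by rewrite vR mul0mx mxE ltxx.
Qed.

Definition kcoef (x : 'rV[R]_d) : 'cV[R]_n := invmx (kmat Psi X) *m kvec Psi X x.

Lemma interpE f x : interp Psi X f x = \sum_k kcoef x k 0 * f (X k).
Proof.
have E : (kvec Psi X x)^T *m invmx (kmat Psi X) = (kcoef x)^T.
  by rewrite /kcoef trmx_mul trmx_inv kmat_sym.
rewrite /interp E mxE; apply: eq_bigr => k _.
by rewrite [(kcoef x)^T _ _]mxE [(\col_ _ _) _ _]mxE.
Qed.

Lemma kmat_kcoef x k : \sum_j kcoef x j 0 * Psi (X k - X j) = Psi (x - X k).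
Proof.
have := congr1 (fun A : 'cV[R]_n => A k 0) (mulKVmx kmat_unit (kvec Psi X x)).
rewrite mxE [RHS]mxE => <-; apply: eq_bigr => j _.
by rewrite [in RHS]mxE mulrC.
Qed.

(** The kriging variance, also known as the squared power function of the design. *)
Definition sqpower (x : 'rV[R]_d) : R :=
  1 - ((kvec Psi X x)^T *m invmx (kmat Psi X) *m kvec Psi X x) 0 0.

Lemma sqpowerE x : sqpower x = 1 - \sum_k kcoef x k 0 * Psi (x - X k).
Proof.
rewrite /sqpower -mulmxA -/(kcoef x) mxE; congr (1 - _); apply: eq_bigr => k _.
by rewrite !mxE mulrC.
Qed.

(** With [krig_pt], the error functional at [x], evaluation minus interpolation, as one combination
    of [n + 1] point evaluations to which the results on [qform] apply. *)
Definition krig_coef (x : 'rV[R]_d) (i : 'I_n.+1) : R :=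
  if unlift ord0 i is Some k then - kcoef x k 0 else 1.
Definition krig_pt (x : 'rV[R]_d) (i : 'I_n.+1) : 'rV[R]_d :=
  if unlift ord0 i is Some k then X k else x.

Lemma krig_sum x (g : 'rV[R]_d -> R) :
  \sum_i krig_coef x i * g (krig_pt x i) = g x - \sum_k kcoef x k 0 * g (X k).
Proof.
rewrite big_ord_recl /krig_coef /krig_pt unlift_none mul1r -sumrN; congr (_ + _).
by apply: eq_bigr => k _; rewrite liftK mulNr.
Qed.

Lemma krig_comb x z : kernel_comb nu (krig_coef x) (krig_pt x) z =
  Psi (z - x) - \sum_k kcoef x k 0 * Psi (z - X k).
Proof. exact: (krig_sum x (fun w => Psi (z - w))). Qed.

Lemma krig_comb_pt x k : kernel_comb nu (krig_coef x) (krig_pt x) (X k) = 0.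
Proof. by rewrite krig_comb kmat_kcoef -(opprB x) MaternN// subrr. Qed.

Lemma krig_comb_self x : kernel_comb nu (krig_coef x) (krig_pt x) x = sqpower x.
Proof. by rewrite krig_comb subrr Matern0 sqpowerE. Qed.

Lemma qform_kernel_comb (I : finType) (u : I -> R) (y : I -> 'rV[R]_d) :
  qform nu u y = \sum_i u i * kernel_comb nu u y (y i).
Proof.
apply: eq_bigr => i _; rewrite /kernel_comb mulr_sumr; apply: eq_bigr => j _.
by rewrite mulrA.
Qed.

(** The kernel combination vanishes on the design, so only the term at [x], of coefficient 1,
    survives. *)
Lemma qform_krig x : qform nu (krig_coef x) (krig_pt x) = sqpower x.
Proof.
rewrite qform_kernel_comb (krig_sum x (kernel_comb nu _ _)) krig_comb_self big1 ?subr0// => k _.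
by rewrite krig_comb_pt mulr0.
Qed.

Lemma sqpower_gt0 x : (forall k, X k <> x) -> 0 < sqpower x.
Proof.
move=> xX; rewrite -qform_krig; apply: qform_gt0 => //.
  move=> i j; rewrite /krig_pt.
  case: unliftP => [k ->|->]; case: unliftP => [l ->|->] //.
  - by move/X_inj ->.
  - by move/xX.
  - by move/esym/xX.
by exists ord0; rewrite /krig_coef unlift_none oner_eq0.
Qed.

Lemma interp_error F v x : native_sqnorm_is Psi F v ->
  `|F x - interp Psi X F x| <= Num.sqrt v * Num.sqrt (sqpower x).
Proof.
move=> Fv; have := native_bound nud (krig_coef x) (krig_pt x) Fv.
rewrite qform_krig (krig_sum x F) -interpE => H.
have v0 := native_sqnorm_ge0 nud Fv.
by rewrite -sqrtrM// -sqrtr_sqr ler_wsqrtr.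
Qed.

Lemma continuous_sqpower : continuous sqpower.
Proof.
have cP k (x : 'rV[R]_d) : Psi (z - X k) @[z --> x] --> Psi (x - X k).
  apply: (@continuous_cvg _ _ _ (nbhs x) _ (fun z => z - X k) Psi).
    exact: continuous_Matern.
  by apply: cvgB; [exact: cvg_id | exact: cvg_cst].
have E z : sqpower z = 1 - \sum_k (\sum_j invmx (kmat Psi X) k j * Psi (z - X j)) * Psi (z - X k).
  rewrite sqpowerE; congr (1 - _); apply: eq_bigr => k _; congr (_ * _).
  by rewrite mxE; apply: eq_bigr => j _; rewrite mxE.
move=> x; rewrite (funext E).
have S : \sum_k (\sum_j invmx (kmat Psi X) k j * Psi (z - X j)) * Psi (z - X k) @[z --> x] -->
    \sum_k (\sum_j invmx (kmat Psi X) k j * Psi (x - X j)) * Psi (x - X k).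
  apply: (@cvg_sum_fin _ _ (nbhs x)) => k; apply: cvgM; last exact: cP.
  apply: (@cvg_sum_fin _ _ (nbhs x)) => j; apply: cvgM; [exact: cvg_cst | exact: cP].
exact: (cvgB (cvg_cst (1 : R)) S).
Qed.

End kriging.

(** * Measure of open and compact sets *)

Section row_topology.
Variables (R : realType) (d : nat).
Local Notation leb := (@tuple_lebesgue R d).

(** Rational boxes form a countable base of open sets that are measurable for the product
    sigma-algebra. This links topology to measure, and lets null neighbourhoods be gathered into a
    null set. *)
Definition rbox (b : {ffun 'I_d -> rat * rat}) : set 'rV[R]_d :=
  [set x | forall i, ratr (b i).1 < x 0 i < ratr (b i).2].

Lemma rbox_nbhs (x : 'rV[R]_d) (U : set 'rV[R]_d) : nbhs x U ->
  exists2 b, rbox b x & rbox b `<=` U.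
Proof.
move=> /nbhs_ballP[e /= e0 eU].
have /fin_all_exists[b Hb] : forall i : 'I_d, exists p : rat * rat,
    x 0 i - e < ratr p.1 < x 0 i /\ x 0 i < ratr p.2 < x 0 i + e.
  move=> i; have [p _ pi] : exists2 p, True & x 0 i - e < ratr p < x 0 i.
    have [|p] := @rat_in_itvoo R (x 0 i - e) (x 0 i); first by rewrite ltrBlDr ltrDl.
    by rewrite in_itv/= => ?; exists p.
  have [q _ qi] : exists2 q, True & x 0 i < ratr q < x 0 i + e.
    have [|q] := @rat_in_itvoo R (x 0 i) (x 0 i + e); first by rewrite ltrDl.
    by rewrite in_itv/= => ?; exists q.
  by exists (p, q).
exists [ffun i => b i].
  move=> i; rewrite ffunE; have [/andP[_ ->] /andP[-> _]] := Hb i; exact: isT.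
move=> z zb; apply: eU; split=> // i j; rewrite ord1 /ball/= ltr_norml.
have := zb j; rewrite ffunE; have [/andP[h1 h2] /andP[h3 h4]] := Hb j.
by move=> /andP[h5 h6]; apply/andP; split; lra.
Qed.

Lemma measurable_rbox b : measurable (@rowt R d @^-1` rbox b).
Proof.
rewrite (_ : _ @^-1` _ = \big[setI/setT]_(i < d)
   ((fun t : d.-tuple R => tnth t i) @^-1` `]ratr (b i).1, ratr (b i).2[)); last first.
  apply/seteqP; split => t.
    move=> tb; rewrite -bigcap_seq => i _ /=; rewrite in_itv/=.
    by have := tb i; rewrite mxE.
  rewrite -bigcap_seq => tb i; have := tb i; rewrite mxE /= in_itv/=; apply.
  by rewrite mem_index_enum.
apply: bigsetI_measurable => i _; rewrite -[X in measurable X]setTI.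
by apply: measurable_tnth => //; exact: measurable_itv.
Qed.

Lemma measurable_open_rows (U : set 'rV[R]_d) : open U -> measurable (@rowt R d @^-1` U).
Proof.
move=> oU.
rewrite (_ : _ @^-1` _ = \bigcup_k (if @unpickle {ffun 'I_d -> rat * rat} k is Some b
    then (if `[< rbox b `<=` U >] then @rowt R d @^-1` rbox b else set0) else set0)).
  apply: bigcupT_measurable => k; case: unpickle => [b|]//; case: asboolP => _//.
  exact: measurable_rbox.
apply/seteqP; split => t.
  move=> tU; have [b bt bU] := rbox_nbhs (open_nbhs_nbhs (conj oU tU)).
  by exists (pickle b) => //; rewrite pickleK; case: asboolP.
by move=> [k _]; case: unpickle => [b|]//; case: asboolP => // bU /bU.
Qed.

Lemma measurable_compact_rows (A : set 'rV[R]_d) : compact A -> measurable (@rowt R d @^-1` A).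
Proof.
move=> cA; rewrite -[A]setCK -preimage_setC; apply: measurableC; apply: measurable_open_rows.
by apply: closed_openC; apply: compact_closed => //; exact: norm_hausdorff.
Qed.

Lemma leb_measureE (A : set 'rV[R]_d) : measurable (@rowt R d @^-1` A) ->
  leb_measure A = leb (@rowt R d @^-1` A).
Proof.
move=> mA; rewrite /leb_measure iint_tuple//.
- by rewrite -[in RHS](setIT (_ @^-1` _)) -integral_indic//.
- apply/measurable_EFinP.
  exact: (measurable_indic mA).
Qed.

End row_topology.

(** The integral of a nonnegative function is a supremum over simple functions below it, so
    monotonicity needs no measurability. This allows arbitrary level sets in the essential
    supremum. *)
Lemma le_integral_ge0 dd (T : measurableType dd) (R : realType)
    (mu : {measure set T -> \bar R}) (f g : T -> \bar R) :
  (forall x, 0 <= f x)%E -> (forall x, f x <= g x)%E ->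
  (\int[mu]_x f x <= \int[mu]_x g x)%E.
Proof.
move=> f0 fg; have g0 x : (0 <= g x)%E by exact: le_trans (fg x).
rewrite !ge0_integralTE//; apply: le_ereal_sup => _ [h hf <-]; exists h => // x.
exact: le_trans (fg x).
Qed.

Section row_measure.
Variable R : realType.

Lemma le_iint n (f g : 'rV[R]_n -> \bar R) : (forall x, 0 <= f x)%E ->
  (forall x, f x <= g x)%E -> (0 <= iint f <= iint g)%E.
Proof.
elim: n f g => [|n IH] f g f0 fg /=; first by rewrite f0 fg.
have H a := IH _ _ (fun t => f0 (row_mx (a%:M : 'M[R]_1) t))
  (fun t => fg (row_mx (a%:M : 'M[R]_1) t)).
apply/andP; split; first by apply: integral_ge0 => a _; case/andP: (H a).
by apply: le_integral_ge0 => a; case/andP: (H a).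
Qed.

Lemma le_leb_measure n (A B : set 'rV[R]_n) : A `<=` B -> (leb_measure A <= leb_measure B)%E.
Proof.
move=> AB; rewrite /leb_measure.
have [] := andP (@le_iint n (fun x => (\1_A x)%:E) (fun x => (\1_B x)%:E) _ _) => // x;
  rewrite lee_fin// !indicE.
by case: (boolP (x \in A)) => // /set_mem/AB/mem_set ->.
Qed.

Lemma leb_measure0 n : leb_measure (set0 : set 'rV[R]_n) = 0%E.
Proof.
rewrite /leb_measure (_ : (fun x => _) = (fun x : 'rV[R]_n => 0%:E)).
  by rewrite (@iint_hasint _ _ (fun=> 0) 0)//; exact: hasint0.
by apply/funext => x; rewrite indic0.
Qed.

Lemma measurable_tuple1 n (t : n.-tuple R) : measurable [set t].
Proof.
rewrite (_ : [set t] = \big[setI/setT]_(i < n)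
   ((fun t : n.-tuple R => tnth t i) @^-1` [set tnth t i])); last first.
  apply/seteqP; split => s.
    by move=> ->; rewrite -bigcap_seq.
  rewrite -bigcap_seq => st /=; apply: eq_from_tnth => i.
  by apply: st; rewrite /= mem_index_enum.
apply: bigsetI_measurable => i _; rewrite -[X in measurable X]setTI.
by apply: measurable_tnth => //; exact: measurable_set1.
Qed.

Lemma leb_point n (t : n.-tuple R) : (0 < n)%N -> tuple_lebesgue R n [set t] = 0%E.
Proof.
case: n t => // n t _; have mt := measurable_tuple1 t.
have -> : tuple_lebesgue R n.+1 [set t] =
    (\int[tuple_lebesgue R n.+1]_s (\1_[set t] s)%:E)%E.
  by rewrite integral_indic// setIT.
rewrite [LHS]cons_measure_tonelli; last 2 first.
- by apply/measurable_EFinP; exact: measurable_indic.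
- by move=> s; rewrite lee_fin.
transitivity (\int[@lebesgue_measure R]_(a in [set thead t])
  \int[tuple_lebesgue R n]_s (\1_[set t] (tcons (a, s)))%:E)%E; last exact: integral_set1.
rewrite [RHS]integral_mkcond; apply: eq_integral => a _; rewrite patchE.
case: ifPn => // /negP at0.
rewrite integral0_eq// => s _; rewrite indicE memNset// => E; apply: at0.
by rewrite inE /= -E.
Qed.

End row_measure.

(** Otherwise each point of [Omega] is a design point or lies in a rational box meeting [Omega] in a
    null set. Design points are null as [0 < d], and there are countably many boxes, so [Omega]
    would be null. *)
Lemma leb_support_point (R : realType) (d n : nat) (Omega : set 'rV[R]_d) (X : 'I_n -> 'rV[R]_d) :
  (0 < d)%N -> compact Omega -> (0 < leb_measure Omega)%E ->
  exists x, [/\ Omega x, forall k, X k <> x &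
    forall U, nbhs x U -> (0 < leb_measure (Omega `&` U))%E].
Proof.
move=> d0 cO O0; apply: contrapT => noX.
have mO := measurable_compact_rows cO.
have mOb b := measurableI _ _ mO (@measurable_rbox R d b).
move: O0; rewrite leb_measureE// ltNge => /negP; apply.
pose leb := tuple_lebesgue R d.
pose N k := if @unpickle {ffun 'I_d -> rat * rat} k is Some b then
   (if `[< leb_measure (Omega `&` rbox b) = 0%E >]
    then @rowt R d @^-1` (Omega `&` rbox b) else set0)
   else set0.
have NN : leb.-negligible (\bigcup_k N k).
  apply: negligible_bigcup => k; rewrite /N; case: unpickle => [b|]; last exact: negligible_set0.
  case: asboolP => [b0|_]; last exact: negligible_set0.
  apply/negligibleP; first exact: mOb.
  by move: b0; rewrite leb_measureE//; exact: mOb.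
pose N' k := if @insub nat (fun k => k < n)%N 'I_n k is Some i then
  @rowt R d @^-1` [set X i] else set0.
have NN' : leb.-negligible (\bigcup_k N' k).
  apply: negligible_bigcup => k; rewrite /N'; case: insub => [i|]; last exact: negligible_set0.
  have [t tX] := rowtP (X i).
  have -> : @rowt R d @^-1` [set X i] = [set t].
    apply/seteqP; split => s /=; last by move=> ->.
    rewrite -tX => /rowP st; apply: eq_from_tnth => j.
    by have := st j; rewrite !mxE.
  apply/negligibleP; last exact: leb_point.
  exact: measurable_tuple1.
have [A [mA A0 NA]] := negligibleU NN NN'.
have OA : @rowt R d @^-1` Omega `<=` A.
  move=> t Ot; apply: NA.
  have [[k Xk]|tX] := pselect (exists k, X k = rowt t).
    by right; exists (val k) => //; rewrite /N' valK /= Xk.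
  left.
  have [U [tU U0]] : exists U, nbhs (rowt t) U /\ ~ (0 < leb_measure (Omega `&` U))%E.
    apply: contrapT => noU; apply: noX; exists (rowt t); split => // [k Xk|U tU].
      by apply: tX; exists k.
    by apply: contrapT => U0; apply: noU; exists U.
  have [b bt bU] := rbox_nbhs tU.
  exists (pickle b) => //; rewrite /N pickleK; case: asboolP => //; case.
  apply/eqP; rewrite eq_le; apply/andP; split; last first.
    by rewrite -(leb_measure0 R d); exact: le_leb_measure.
  apply: le_trans (_ : (leb_measure (Omega `&` U) <= 0)%E); last by rewrite leNgt; apply/negP.
  by apply: le_leb_measure; exact: setIS.
rewrite -[X in (_ <= X)%E]A0; apply: le_measure => //; rewrite inE//.
Qed.

(** By symmetry of the density, the half line up to 0 has mass 1/2, which is less than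
    [1 - beta / 2]. *)
Lemma normal_quantile_gt0 (R : realType) (beta q : R) : 0 < beta < 1 ->
  normal_prob 0 1 `]-oo, q] = (1 - beta / 2)%:E -> 0 < q.
Proof.
move=> /andP[b0 b1] qE; rewrite ltNge; apply/negP => q0.
pose f := @normal_pdf R 0 1; pose mu := @lebesgue_measure R.
have f0 x : 0 <= f x by exact: normal_pdf_ge0.
have mf : measurable_fun setT f by exact: measurable_normal_pdf.
have fN x : f (- x) = f x by rewrite /f /normal_pdf oner_eq0 /normal_fun !subr0 sqrrN.
pose h := (\int[mu]_(x in `]-oo, 0%R]) (f x)%:E)%E.
have hE : (h = \int[mu]_(x in [set x | 0 < x]%R) (f x)%:E)%E.
  rewrite /h; under eq_integral do rewrite -fN.
  rewrite -(@ge0_integration_by_substitution0 R (fun x => (f x)%:E)).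
  - by rewrite -integral_itv_obnd_cbnd ?set_itvoy//; exact/measurable_EFinP/measurable_funTS.
  - exact/measurable_EFinP.
  - by move=> x; rewrite lee_fin.
have hh : (h + h = 1)%E.
  rewrite -[RHS](@integral_normal_pdf R 0 1) -(integral_symmetric mf f0) {2}hE hE.
  under [in RHS]eq_integral do rewrite fN EFinD.
  rewrite -set_itvoy ge0_integralD//.
  - by move=> x _; rewrite lee_fin.
  - exact/measurable_EFinP/measurable_funTS.
  - by move=> x _; rewrite lee_fin.
  - exact/measurable_EFinP/measurable_funTS.
have : ((1 - beta / 2)%:E <= h)%E.
  rewrite -qE /normal_prob /h; apply: ge0_subset_integral => //.
  - exact/measurable_EFinP/measurable_funTS.
  - by move=> x _; rewrite lee_fin; exact: f0.
  - by move=> x /=; rewrite !in_itv/= => /le_trans; exact.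
move=> H; have := leeD H H; rewrite hh -EFinD lee_fin; lra.
Qed.

(** * The two bounds on the worst ratio *)

Section worst_case.
Variables (R : realType) (d : nat) (nu q : R) (Omega : set 'rV[R]_d).
Hypotheses (nud : d%:R / 2 < nu) (q0 : 0 < q).
Local Notation Psi := (@Matern R d nu).
Variables (n : nat) (X : 'I_n -> 'rV[R]_d).
Hypotheses (X_inj : injective X) (XO : forall k, Omega (X k)).

Lemma CI_lengthE x : CI_length Psi X q x = 2 * q * Num.sqrt (sqpower nu X x).
Proof. by []. Qed.

(** The norm on [Omega] is an infimum that is not known to be attained: an extension of norm below
    [1 + e] is used, and [e] is sent to 0. *)
Lemma error_le_power f x : (native_norm_on Psi Omega f <= 1)%E -> Omega x ->
  `|f x - interp Psi X f x| <= Num.sqrt (sqpower nu X x).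
Proof.
move=> f1 Ox; set p := Num.sqrt _; have p0 : 0 <= p by exact: sqrtr_ge0.
suff H e : 0 < e -> `|f x - interp Psi X f x| <= (1 + e) * p.
  apply/ler_addgt0Pr => e e0.
  have p1 : 0 < p + 1 by rewrite ltr_wpDl.
  apply: le_trans (H (e / (p + 1)) _) _; first by rewrite divr_gt0.
  by rewrite mulrDl mul1r lerD2l mulrAC ler_pdivrMr// ler_wpM2l ?(ltW e0)// lerDl.
move=> e0; have : (native_norm_on Psi Omega f < (1 + e)%:E)%E.
  by apply: le_lt_trans f1 _; rewrite lte_fin ltrDl.
move=> /ereal_inf_lt[_ [v [F [Fv FE]] <-]]; rewrite lte_fin => ve.
have -> : f x - interp Psi X f x = F x - interp Psi X F x.
  rewrite !(interpE nud) FE//; congr (_ - _).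
  by apply: eq_bigr => k _; rewrite FE.
apply: le_trans (interp_error nud X_inj x Fv) _.
by rewrite ler_wpM2r// ltW.
Qed.

Lemma worst_ratio_le : (worst_ratio Psi Omega X q 1 <= ((2 * q)^-1)%:E)%E.
Proof.
have q20 : 0 < 2 * q by rewrite mulr_gt0.
apply: ge_ereal_sup => _ [f /= f1 <-]; apply: ereal_inf_lbound => /=.
rewrite (_ : [set x | _] = set0) ?leb_measure0//.
apply/seteqP; split => // x [Ox]; rewrite lte_fin ltNge => /negP; apply.
have := error_le_power f1 Ox; rewrite CI_lengthE; set p := Num.sqrt _; set E := f x - _.
(* Where the interval has length 0 the quotient is 0, since the inverse of 0 is 0. *)
move=> Ep; have [->|p0] := eqVneq p 0.
  by rewrite mulr0 invr0 mulr0 normr0 invr_ge0 ltW.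
have {}p0 : 0 < p by rewrite lt_neqAle eq_sym p0 sqrtr_ge0.
rewrite normrM normfV (gtr0_norm (mulr_gt0 q20 p0)) ler_pdivrMr ?mulr_gt0//.
by rewrite mulKf// gt_eqF.
Qed.

Lemma worst_ratio_ge (a : R) : (0 < d)%N -> compact Omega -> (0 < leb_measure Omega)%E -> 0 < a ->
  (((4 * q)^-1 * a)%:E <= worst_ratio Psi Omega X q a)%E.
Proof.
move=> d0 cO O0 a0; have [x0 [Ox0 xX supp]] := leb_support_point X d0 cO O0.
have P0 := sqpower_gt0 nud X_inj xX.
set Q := sqpower nu X x0 in P0.
have s0 : 0 < Num.sqrt Q by rewrite sqrtr_gt0.
(* The error functional at [x0] has squared norm [Q], so this scaling gives norm [a], and the value
   of [f] at [x0] is [a * sqrt Q]. *)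
pose u i := a / Num.sqrt Q * krig_coef nu X x0 i.
pose y := krig_pt X x0.
pose f := kernel_comb nu u y.
have fE z : f z = a / Num.sqrt Q * kernel_comb nu (krig_coef nu X x0) y z.
  by rewrite /f /kernel_comb mulr_sumr; apply: eq_bigr => i _; rewrite mulrA.
have fX k : f (X k) = 0 by rewrite fE krig_comb_pt// mulr0.
have fx0 : f x0 = a * Num.sqrt Q.
  by rewrite fE krig_comb_self// -/Q -{2}(sqr_sqrtr (ltW P0)) expr2 mulrA divfK// gt_eqF.
have qa : qform nu u y = a ^+ 2.
  have -> : qform nu u y = (a / Num.sqrt Q) ^+ 2 * qform nu (krig_coef nu X x0) y.
    rewrite /qform mulr_sumr; apply: eq_bigr => i _; rewrite mulr_sumr.
    by apply: eq_bigr => j _; rewrite /u; ring.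
  by rewrite qform_krig// -/Q expr_div_n sqr_sqrtr ?(ltW P0)// divfK// gt_eqF.
have fnorm : (native_norm_on Psi Omega f <= a%:E)%E.
  apply: ereal_inf_lbound => /=; exists (a ^+ 2); last by rewrite sqrtr_sqr gtr0_norm.
  by exists f; split => //; rewrite -qa; exact: kernel_comb_native.
apply: le_trans (ereal_sup_ubound _); last by exists f; [exact: fnorm | reflexivity].
(* If an essential bound [M] were below the claimed value, the ratio would exceed it on a
   neighbourhood of [x0], whose trace on [Omega] has positive measure. *)
apply: le_ereal_inf_tmp => M /= M0; rewrite leNgt; apply/negP => MC.
pose h x := (f x - interp Psi X f x) / CI_length Psi X q x.
have hE x : h x = f x / (2 * q * Num.sqrt (sqpower nu X x)).
  by rewrite /h interpE// big1 ?subr0// => k _; rewrite fX mulr0.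
have q20 : 0 < 2 * q by rewrite mulr_gt0.
have hx0 : h x0 = a / (2 * q).
  by rewrite hE fx0 -/Q; field; rewrite !gt_eqF.
have c1 : f x @[x --> x0] --> f x0 by exact: continuous_kernel_comb.
have c2 : Num.sqrt (sqpower nu X x) @[x --> x0] --> Num.sqrt Q.
  apply: (@continuous_cvg _ _ _ (nbhs x0) _ (sqpower nu X) Num.sqrt).
    exact: sqrt_continuous.
  exact: continuous_sqpower.
have n0 : 2 * q * Num.sqrt Q != 0 by rewrite gt_eqF// mulr_gt0.
have ch : h x @[x --> x0] --> h x0.
  by rewrite (funext hE); exact: (cvgM c1 (cvgV n0 (cvgM (cvg_cst (2 * q)) c2))).
have hgt : (4 * q)^-1 * a < h x0.
  rewrite hx0 mulrC ltr_pM2l// ltf_pV2 ?posrE ?mulr_gt0// ltr_pM2r// ltr_nat//.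
have nU : \forall x \near x0, (4 * q)^-1 * a < h x by exact: (cvgr_gt _ ch).
have := supp _ nU.
rewrite lt_neqAle => /andP[/eqP + _]; apply; apply/esym/eqP; rewrite eq_le; apply/andP; split.
  rewrite -M0; apply: le_leb_measure => x [Ox xU]; split => //.
  apply: lt_trans MC _; rewrite lte_fin; apply: lt_le_trans xU _; exact: ler_norm.
by rewrite -(leb_measure0 R d); exact: le_leb_measure.
Qed.

End worst_case.

Theorem theorem3p2 (R : realType) (d : nat) (Omega : set 'rV[R]_d) (nu beta q : R) :
  (0 < d)%N ->
  convex_set Omega -> compact Omega -> (0 < leb_measure Omega)%E ->
  d%:R / 2 < nu ->
  0 < beta < 1 ->
  (* q = Phi^{-1}(1 - beta/2), Phi the standard normal c.d.f. *)
  normal_prob 0 1 `]-oo, q] = (1 - beta / 2)%:E ->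
  (forall (X : forall n : nat, 'I_n -> 'rV[R]_d) (c1 c2 : R),
      sampling_scheme Omega X -> 0 < c1 -> 0 < c2 -> fill_condition Omega X c1 c2 ->
      forall n : nat, (0 < n)%N ->
        (worst_ratio (@Matern R d nu) Omega (X n) q 1 <= ((2 * q)^-1)%:E)%E)
  /\
  (forall c1 c2 : R, 0 < c1 -> 0 < c2 ->
    exists C : R, 0 < C /\
      forall (X : forall n : nat, 'I_n -> 'rV[R]_d),
        sampling_scheme Omega X -> fill_condition Omega X c1 c2 ->
        forall a : nat -> R, (forall n, 0 < a n) ->
          {homo a : m n / (m <= n)%N >-> m <= n} ->
          a @ \oo --> +oo ->
          forall n : nat, (0 < n)%N ->
            ((C * a n)%:E <= worst_ratio (@Matern R d nu) Omega (X n) q (a n))%E).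
Proof.
move=> d0 _ cO O0 nud b01 qE; have q0 := normal_quantile_gt0 b01 qE.
split=> [X c1 c2 Xs _ _ _ n _|c1 c2 _ _].
  by have [X_inj XO] := Xs n; exact: worst_ratio_le.
exists (4 * q)^-1; split; first by rewrite invr_gt0 mulr_gt0.
move=> X Xs _ a a0 _ _ n _; have [X_inj _] := Xs n.
exact: worst_ratio_ge.
Qed.
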